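(* Let $p\ge3$ be odd, let $q$ be a primitive $p$-th root of unity, and let $A_0(E_q(1,1))=C_0^\infty(\mathbb R^2)\otimes A(E(1,1\mid p))$ be the space of finite sums $F=\sum_n a_nf_n$ with $a_n\in A(E(1,1\mid p))$, $f_n\in C_0^\infty(\mathbb R^2)$. Then the linear functional $$\mathcal I_E(F)=\sum_n\mathcal I(a_n)\,\mathcal I_C(f_n)$$ is an invariant integral on the quantum Poincaré group $E_q(1,1)$, i.e. for all $F\in A_0(E_q(1,1))$ $$(\mathrm{id}\otimes\mathcal I_E)\Delta(F)=\mathcal I_E(F)\,1_A,\qquad (\mathcal I_E\otimes\mathrm{id})\Delta(F)=\mathcal I_E(F)\,1_A,$$ and it is the unique one up to a scalar: every linear functional on $A_0(E_q(1,1))$ satisfying both invariance conditions is a complex multiple of $\mathcal I_E$.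
   Context: $A(E(1,1\mid p))$ is the unital complex algebra generated by $\eta_\pm,\delta$ with relations $\eta_-\eta_+=q^2\eta_+\eta_-$, $\eta_\pm\delta=q^2\delta\eta_\pm$, $\delta^p=1_A$, $\eta_\pm^p=0$ (basis $\eta_+^n\eta_-^m\delta^k$, $0\le n,m,k\le p-1$), with coproduct $\Delta(\eta_\pm)=\eta_\pm\otimes1_A+\delta^{\pm1}\otimes\eta_\pm$, $\Delta(\delta)=\delta\otimes\delta$. On it, $\mathcal I(\eta_+^n\eta_-^m\delta^k)=q^{-1}\delta_{n,p-1}\delta_{m,p-1}\delta_{k,0(\mathrm{mod}\,p)}$ (Kronecker deltas). $C^\infty(\mathbb R^2)$ is the algebra of smooth complex functions of $z=(z_+,z_-)\in\mathbb R^2$, $C_0^\infty(\mathbb R^2)$ those of compact support, and $\mathcal I_C(f)=\int_{\mathbb R^2}f(z_+,z_-)\,dz_+dz_-$. The quantum Poincaré group $E_q(1,1)$ at the root of unity $q$ is the algebra $A(E_q(1,1))=A(E(1,1\mid p))\otimes C^\infty(\mathbb R^2)$ (functions of $z$ commute with $\eta_\pm,\delta$), with unit $1_A$. Its coproduct is multiplicative, given on the generators of $A(E(1,1\mid p))$ by $\Delta(\eta_\pm)=\eta_\pm\otimes1_A+\delta^{\pm1}\otimes\eta_\pm$, $\Delta(\delta)=\delta\otimes\delta$, and on $f\in C^\infty(\mathbb R^2)$ by $$\Delta(f)=f(Z)+\frac{\partial f}{\partial z_+}(Z)\,B_++\frac{\partial f}{\partial z_-}(Z)\,B_-+\frac{\partial^2f}{\partial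 z_+\partial z_-}(Z)\,B_+B_-,$$ where $Z_\pm=z_\pm\otimes1+1\otimes z_\pm$ (so $g(Z)$ is the smooth function $(z',z'')\mapsto g(z'+z'')$ on $\mathbb R^2\times\mathbb R^2$) and $$B_\pm=(-1)^{\frac{p+1}2}\sum_{n=1}^{p-1}\frac{q^{\pm n^2}}{[p-n]!\,[n]!}\,\eta_\pm^{p-n}\delta^{\pm n}\otimes\eta_\pm^n,\qquad [n]=\frac{q^n-q^{-n}}{q-q^{-1}},\ [n]!=[1]\cdots[n].$$ Thus $\Delta(F)$ lies in $C^\infty(\mathbb R^2\times\mathbb R^2)\otimes A(E(1,1\mid p))\otimes A(E(1,1\mid p))$. For a linear functional $\varphi$ on $A_0(E_q(1,1))$, $(\mathrm{id}\otimes\varphi)\Delta(F)$ is obtained by fixing the first variable $z'$ and the first $A(E(1,1\mid p))$-leg and applying $\varphi$ in the second variable and second leg (for fixed $z'$ the function $z''\mapsto g(z'+z'')$ has compact support when $g$ does); similarly for $(\varphi\otimes\mathrm{id})\Delta(F)$. The identities are equalities of $A(E(1,1\mid p))$-valued functions of the remaining variable. *)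

(* Defs.v *)
From HB Require Import structures.
From mathcomp Require Import all_boot all_order all_algebra.
From mathcomp Require Import complex ring.
From mathcomp Require Import all_classical all_reals all_analysis.

Set Implicit Arguments.
Unset Strict Implicit.
Unset Printing Implicit Defensive.

Import Order.TTheory GRing.Theory Num.Theory.
Import numFieldNormedType.Exports.

Local Open Scope classical_set_scope.
Local Open Scope ring_scope.

Section Algebra.
Variables (K : fieldType) (p : nat) (q : K) (hq : p.-primitive_root q).

(* Exponents (n, m, k) of the basis element eta_+^n eta_-^m delta^k. *)
Definition AEidx : finType := ('I_p * 'I_p * 'I_p)%type.

Definition expo (i : AEidx) : nat * nat * nat := (i.1.1 : nat, i.1.2 : nat, i.2 : nat).

(* Exponents in nat are brought back to the basis by delta^p = 1; when n >= p or
   m >= p no basis element qualifies, which is how eta_+^p = eta_-^p = 0 enters. *)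
Definition reduces_to (t : nat * nat * nat) (l : AEidx) : bool :=
  [&& t.1.1 == l.1.1 :> nat, t.1.2 == l.1.2 :> nat & t.2 %% p == l.2 :> nat]%N.

(* Reordering (eta_+^n eta_-^m delta^k) (eta_+^n' eta_-^m' delta^k') with
   eta_- eta_+ = q^2 eta_+ eta_-  and  eta_(+/-) delta = q^2 delta eta_(+/-)
   produces the factor q^(2 m n' - 2 k (n' + m')). *)
Definition twist (s t : nat * nat * nat) : K :=
  q ^+ (2 * (s.1.2 * t.1.1)) / q ^+ (2 * (s.2 * (t.1.1 + t.1.2))).

Definition addexp (s t : nat * nat * nat) : nat * nat * nat :=
  (s.1.1 + t.1.1, s.1.2 + t.1.2, s.2 + t.2)%N.

(* The tensor product of A(E(1,1|p)) and an algebra B: a family x stands for the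
   sum over i of (basis element i) (x) (x i).  The proof h is an argument because
   the ring structure put on this type below depends on q. *)
Definition AEt (h : p.-primitive_root q) (B : algType K) : Type := {ffun AEidx -> B}.

Section Coefficients.
Variable B : algType K.
Local Notation T := (AEt hq B).

HB.instance Definition _ := GRing.Lmodule.copy T {ffun AEidx -> B}.

Definition AEt_pure (t : nat * nat * nat) (b : B) : T :=
  [ffun l => if reduces_to t l then b else 0].

Definition AEt_mul (x y : T) : T :=
  \sum_(i : AEidx) \sum_(j : AEidx)
    twist (expo i) (expo j) *: AEt_pure (addexp (expo i) (expo j)) (x i * y j).

Definition AEt_one : T := AEt_pure (0, 0, 0)%N 1.

Let p_gt0 : (0 < p)%N. Proof. exact: prim_order_gt0 hq. Qed.
Let qp1 : q ^+ p = 1. Proof. exact: prim_expr_order hq. Qed.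
Let q_neq0 : q != 0.
Proof.
apply/eqP=> q0; move: qp1; rewrite q0 expr0n eqn0Ngt p_gt0 /= => /esym/eqP.
by rewrite oner_eq0.
Qed.

Lemma reducesP (t : nat * nat * nat) :
  {l : AEidx | [/\ (t.1.1 < p)%N, (t.1.2 < p)%N, expo l = (t.1.1, t.1.2, t.2 %% p)%N
              & reduces_to t =1 pred1 l]} +
  {((p <= t.1.1) || (p <= t.1.2))%N /\ reduces_to t =1 pred0}.
Proof.
case: (ltnP t.1.1 p) => h1; last first.
  right; split=> // l; apply/negP => /and3P[/eqP e _ _].
  by move: h1; rewrite e leqNgt ltn_ord.
case: (ltnP t.1.2 p) => h2; last first.
  right; split; first by rewrite orbT.
  move=> l; apply/negP => /and3P[_ /eqP e _].
  by move: h2; rewrite e leqNgt ltn_ord.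
left; exists (Ordinal h1, Ordinal h2, Ordinal (ltn_pmod t.2 p_gt0)); split=> //.
move=> [[a b] c]; apply/and3P/eqP => /= [[/eqP h /eqP h' /eqP h'']|[-> -> ->] //].
by congr (_, _, _); apply: val_inj.
Qed.

Lemma AEtP (x y : T) : x =1 y -> x = y.
Proof. by move/ffunP. Qed.

Lemma AEt_pureB t : {morph AEt_pure t : b b' / b - b'}.
Proof. by move=> b b'; apply: AEtP => l; rewrite !ffunE; case: ifP; rewrite ?subr0. Qed.
Lemma AEt_pureD t : {morph AEt_pure t : b b' / b + b'}.
Proof. by move=> b b'; apply: AEtP => l; rewrite !ffunE; case: ifP; rewrite ?addr0. Qed.
Lemma AEt_pure0 t : AEt_pure t 0 = 0.
Proof. by apply: AEtP => l; rewrite !ffunE; case: ifP. Qed.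
Lemma AEt_pureZ t a b : AEt_pure t (a *: b) = a *: AEt_pure t b.
Proof. by apply: AEtP => l; rewrite !ffunE; case: ifP; rewrite ?scaler0. Qed.
Lemma AEt_pure_sum t (I : finType) (F : I -> B) :
  AEt_pure t (\sum_i F i) = \sum_i AEt_pure t (F i).
Proof. exact: (big_morph _ (AEt_pureD t) (AEt_pure0 t)). Qed.

Lemma AEt_decomp (x : T) : x = \sum_i AEt_pure (expo i) (x i).
Proof.
apply: AEtP => l; rewrite sum_ffunE (bigD1 l) //= big1 ?addr0.
  by rewrite ffunE /reduces_to /= !eqxx modn_small ?eqxx.
move=> i il; rewrite ffunE; case: ifP => // /and3P[/= /eqP a /eqP b].
rewrite modn_small // => /eqP c; case/eqP: il.
by case: i l a b c => [[? ?] ?] [[? ?] ?] /= /val_inj-> /val_inj-> /val_inj->.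
Qed.

Lemma expr_modp n : q ^+ (n %% p) = q ^+ n.
Proof. exact: expr_mod. Qed.

Lemma twist_mod a b c a' b' c' :
  twist (a, b, c %% p)%N (a', b', c')%N = twist (a, b, c)%N (a', b', c')%N.
Proof.
rewrite /twist /=; congr (_ / _); rewrite !mulnA ![(2 * _)%N]mulnC -!mulnA.
by rewrite exprM expr_modp -exprM.
Qed.

Lemma AEt_mulE s t b b' :
  AEt_mul (AEt_pure s b) (AEt_pure t b') =
  twist s t *: AEt_pure (addexp s t) (b * b').
Proof.
rewrite /AEt_mul; case: (reducesP s) => [[i [s1 s2 ei si]]|[s12 sn]]; last first.
  rewrite big1 => [|i _]; last first.
    by rewrite big1 // => j _; rewrite ffunE sn mul0r AEt_pure0 scaler0.
  apply: AEtP => l; rewrite !ffunE; case: ifP; rewrite ?scaler0 //.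
  case/and3P=> /= /eqP h1 /eqP h2 _; case/orP: s12; rewrite leqNgt.
    by rewrite (leq_ltn_trans _ (ltn_ord l.1.1)) // -h1 leq_addr.
  by rewrite (leq_ltn_trans _ (ltn_ord l.1.2)) // -h2 leq_addr.
rewrite (bigD1 i) //= [X in _ + X]big1 ?addr0; last first.
  move=> i' /negPf ii'; rewrite big1 // => j _.
  by rewrite ffunE si /= ii' mul0r AEt_pure0 scaler0.
case: (reducesP t) => [[j [t1 t2 ej tj]]|[t12 tn]]; last first.
  rewrite big1 => [|j _]; last first.
    by rewrite !ffunE tn mulr0 AEt_pure0 scaler0.
  apply: AEtP => l; rewrite !ffunE; case: ifP; rewrite ?scaler0 //.
  case/and3P=> /= /eqP h1 /eqP h2 _; case/orP: t12; rewrite leqNgt.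
    by rewrite (leq_ltn_trans _ (ltn_ord l.1.1)) // -h1 leq_addl.
  by rewrite (leq_ltn_trans _ (ltn_ord l.1.2)) // -h2 leq_addl.
rewrite (bigD1 j) //= [X in _ + X]big1 ?addr0; last first.
  by move=> j' /negPf jj'; rewrite !ffunE tj /= jj' mulr0 AEt_pure0 scaler0.
rewrite !ffunE si tj /= !eqxx ei ej twist_mod /addexp /=.
case: s t {si tj ei ej s1 s2 t1 t2} => [[? ?] ?] [[? ?] ?]; congr (_ *: _).
by apply: AEtP => l; rewrite !ffunE /reduces_to /= modnDm.
Qed.

Lemma AEt_mulDl : left_distributive AEt_mul +%R.
Proof.
move=> x y z; rewrite /AEt_mul -big_split; apply: eq_bigr => i _.
rewrite -big_split; apply: eq_bigr => j _.
by rewrite /= -scalerDr -AEt_pureD -mulrDl ffunE.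
Qed.

Lemma AEt_mulDr : right_distributive AEt_mul +%R.
Proof.
move=> x y z; rewrite /AEt_mul -big_split; apply: eq_bigr => i _.
rewrite -big_split; apply: eq_bigr => j _.
by rewrite /= -scalerDr -AEt_pureD -mulrDr ffunE.
Qed.

Lemma AEt_mulZl (a : K) x y : a *: AEt_mul x y = AEt_mul (a *: x) y.
Proof.
rewrite /AEt_mul scaler_sumr; apply: eq_bigr => i _.
rewrite scaler_sumr; apply: eq_bigr => j _.
by rewrite ffunE -scalerAl AEt_pureZ !scalerA mulrC.
Qed.

Lemma AEt_mulZr (a : K) x y : a *: AEt_mul x y = AEt_mul x (a *: y).
Proof.
rewrite /AEt_mul scaler_sumr; apply: eq_bigr => i _.
rewrite scaler_sumr; apply: eq_bigr => j _.
by rewrite ffunE -scalerAr AEt_pureZ !scalerA mulrC.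
Qed.

Lemma AEt_mul0l y : AEt_mul 0 y = 0.
Proof. by rewrite -[0 in LHS](scale0r (0 : T)) -AEt_mulZl scale0r. Qed.
Lemma AEt_mul0r y : AEt_mul y 0 = 0.
Proof. by rewrite -[0 in LHS](scale0r (0 : T)) -AEt_mulZr scale0r. Qed.

Lemma AEt_mul_suml (I : finType) (F : I -> T) y :
  AEt_mul (\sum_i F i) y = \sum_i AEt_mul (F i) y.
Proof. exact: (big_morph (AEt_mul^~ y) (fun a b => AEt_mulDl a b y) (AEt_mul0l y)). Qed.
Lemma AEt_mul_sumr (I : finType) (F : I -> T) y :
  AEt_mul y (\sum_i F i) = \sum_i AEt_mul y (F i).
Proof. exact: (big_morph (AEt_mul y) (AEt_mulDr y) (AEt_mul0r y)). Qed.

Lemma twistA s t u :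
  twist s t * twist (addexp s t) u = twist t u * twist s (addexp t u).
Proof.
rewrite /twist /=; rewrite !mulnDl !mulnDr !exprD; field.
by rewrite !expf_neq0.
Qed.

Lemma AEt_mulA : associative AEt_mul.
Proof.
move=> x y z; rewrite (AEt_decomp x) !AEt_mul_suml; apply: eq_bigr => i _.
rewrite (AEt_decomp y) !(AEt_mul_suml, AEt_mul_sumr); apply: eq_bigr => j _.
rewrite (AEt_decomp z) !AEt_mul_sumr; apply: eq_bigr => k _.
rewrite !AEt_mulE -AEt_mulZl -AEt_mulZr !AEt_mulE !scalerA twistA mulrA.
by rewrite /addexp /= !addnA.
Qed.

Lemma AEt_mul1l : left_id AEt_one AEt_mul.
Proof.
move=> x; rewrite [in LHS](AEt_decomp x) [RHS](AEt_decomp x) AEt_mul_sumr.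
apply: eq_bigr => i _; rewrite AEt_mulE /twist /= !expr0 divr1 scale1r mul1r.
by rewrite /addexp /= !add0n.
Qed.

Lemma AEt_mul1r : right_id AEt_one AEt_mul.
Proof.
move=> x; rewrite [in LHS](AEt_decomp x) [RHS](AEt_decomp x) AEt_mul_suml.
apply: eq_bigr => i _; rewrite AEt_mulE /twist /= !muln0 !expr0 divr1 scale1r mulr1.
by rewrite /addexp /= !addn0.
Qed.

Lemma AEt_oner_neq0 : AEt_one != 0.
Proof.
apply/eqP=> /ffunP/(_ (Ordinal p_gt0, Ordinal p_gt0, Ordinal p_gt0)).
by rewrite !ffunE /reduces_to /= mod0n eqxx => /eqP; rewrite oner_eq0.
Qed.

HB.instance Definition _ := GRing.Zmodule_isNzRing.Build T
  AEt_mulA AEt_mul1l AEt_mul1r AEt_mulDl AEt_mulDr AEt_oner_neq0.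
HB.instance Definition _ := GRing.Lmodule_isLalgebra.Build K T AEt_mulZl.
HB.instance Definition _ := GRing.Lalgebra_isAlgebra.Build K T AEt_mulZr.
End Coefficients.

(* A(E(1,1|p)) itself *)
Definition AE : algType K := AEt hq K^o.

Definition etaP : AE := AEt_pure (1, 0, 0)%N 1.
Definition etaM : AE := AEt_pure (0, 1, 0)%N 1.
Definition delta : AE := AEt_pure (0, 0, 1)%N 1.
(* delta^(-1) *)
Definition deltaV : AE := delta ^+ p.-1.

Definition AEmon (i : AEidx) : AE := etaP ^+ i.1.1 * etaM ^+ i.1.2 * delta ^+ i.2.

Let p_gt0 : (0 < p)%N. Proof. exact: prim_order_gt0 hq. Qed.
Let qp1 : q ^+ p = 1. Proof. exact: prim_expr_order hq. Qed.
Let q_neq0 : q != 0.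
Proof.
apply/eqP=> q0; move: qp1; rewrite q0 expr0n eqn0Ngt p_gt0 /= => /esym/eqP.
by rewrite oner_eq0.
Qed.

Let pureM s t :
  (AEt_pure s 1 : AE) * AEt_pure t 1 = twist s t *: (AEt_pure (addexp s t) 1 : AE).
Proof. by rewrite [LHS]AEt_mulE mul1r. Qed.

Lemma etaP_exp n : etaP ^+ n = AEt_pure (n, 0, 0)%N 1.
Proof.
elim: n => [|n IH]; first by [].
by rewrite exprSr IH pureM /twist /addexp /= !mul0n expr0 divr1 scale1r addn1.
Qed.
Lemma etaM_exp n : etaM ^+ n = AEt_pure (0, n, 0)%N 1.
Proof.
elim: n => [|n IH]; first by [].
by rewrite exprSr IH pureM /twist /addexp /= muln0 !mul0n expr0 divr1 scale1r addn1.
Qed.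
Lemma delta_exp n : delta ^+ n = AEt_pure (0, 0, n)%N 1.
Proof.
elim: n => [|n IH]; first by [].
by rewrite exprSr IH pureM /twist /addexp /= !muln0 expr0 divr1 scale1r addn1.
Qed.

Lemma monE n m k : etaP ^+ n * etaM ^+ m * delta ^+ k = AEt_pure (n, m, k) 1.
Proof.
rewrite etaP_exp etaM_exp delta_exp pureM -scalerAl pureM /twist /addexp /=.
by rewrite !muln0 ?mul0n !expr0 !divr1 !scale1r ?(addn0, add0n).
Qed.

Lemma etaMP : etaM * etaP = q ^+ 2 *: (etaP * etaM).
Proof. by rewrite !pureM /twist /= !muln0 muln1 expr0 !divr1 scale1r. Qed.
Lemma etaP_delta : etaP * delta = q ^+ 2 *: (delta * etaP).
Proof.
by rewrite !pureM scalerA /twist /= !(muln0, mul0n, muln1, addn0, add0n) !expr0 divr1 mul1r mulfV ?expf_neq0.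
Qed.
Lemma etaM_delta : etaM * delta = q ^+ 2 *: (delta * etaM).
Proof.
by rewrite !pureM scalerA /twist /= !(muln0, mul0n, muln1, addn0, add0n) !expr0 divr1 mul1r mulfV ?expf_neq0.
Qed.
Lemma delta_expp : delta ^+ p = 1.
Proof.
rewrite delta_exp; apply: AEtP => l; rewrite !ffunE /reduces_to /=.
by rewrite modnn mod0n.
Qed.
Lemma etaP_expp : etaP ^+ p = 0.
Proof.
rewrite etaP_exp; apply: AEtP => l; rewrite !ffunE; case: ifP => // /and3P[/= /eqP h].
by move: (ltn_ord l.1.1); rewrite -h ltnn.
Qed.
Lemma etaM_expp : etaM ^+ p = 0.
Proof.
rewrite etaM_exp; apply: AEtP => l; rewrite !ffunE; case: ifP => // /and3P[/= _ /eqP h].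
by move: (ltn_ord l.1.2); rewrite -h ltnn.
Qed.

(* The monomials form a basis, with x i the coordinate of x on AEmon i. *)
Lemma AEmonE i j : AEmon i j = (i == j)%:R.
Proof.
rewrite /AEmon monE ffunE /reduces_to /=; case: (i =P j) => [<-|ij].
  by rewrite !eqxx modn_small ?eqxx.
case: ifP => // /and3P[/= /eqP a /eqP b].
rewrite modn_small // => /eqP c; case: ij.
by case: i j a b c => [[? ?] ?] [[? ?] ?] /= /val_inj-> /val_inj-> /val_inj->.
Qed.
Lemma AEmon_decomp (x : AE) : x = \sum_i x i *: AEmon i.
Proof.
apply: AEtP => j; rewrite sum_ffunE (bigD1 j) //= ffunE AEmonE eqxx big1.
  by rewrite addr0 [RHS]mulr1.
by move=> i /negPf ij; rewrite ffunE AEmonE ij scaler0.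
Qed.

Lemma qcommX (D : algType K) (X Y : D) c m n :
  Y * X = c *: (X * Y) -> Y ^+ m * X ^+ n = c ^+ (m * n) *: (X ^+ n * Y ^+ m).
Proof.
move=> YX; have YXn k : Y * X ^+ k = c ^+ k *: (X ^+ k * Y).
  elim: k => [|k IH]; first by rewrite !expr0 mulr1 mul1r scale1r.
  by rewrite [X ^+ k.+1]exprSr mulrA IH -scalerAl -[(X ^+ k * Y) * X]mulrA YX -scalerAr scalerA mulrA -!exprSr.
elim: m => [|m IH]; first by rewrite !expr0 mulr1 mul1r scale1r.
rewrite [Y ^+ m.+1]exprS -mulrA IH -scalerAr [Y * (_ * _)]mulrA YXn -scalerAl scalerA.
by rewrite -[(_ * Y) * _]mulrA -exprD addnC mulSn.
Qed.

(* Universal property: AE is the algebra presented by the generators etaP, etaM,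
   delta and the relations etaMP, etaP_delta, etaM_delta, delta_expp, etaP_expp,
   etaM_expp. *)
Section Presentation.
Variables (D : algType K) (X Y Z : D).
Hypotheses (YX : Y * X = q ^+ 2 *: (X * Y)) (XZ : X * Z = q ^+ 2 *: (Z * X))
  (YZ : Y * Z = q ^+ 2 *: (Z * Y)) (Zp : Z ^+ p = 1) (Xp : X ^+ p = 0) (Yp : Y ^+ p = 0).

Definition AEhom (x : AE) : D := \sum_i x i *: (X ^+ i.1.1 * Y ^+ i.1.2 * Z ^+ i.2).

Let M (t : nat * nat * nat) := X ^+ t.1.1 * Y ^+ t.1.2 * Z ^+ t.2.

Let exp_ge (U : D) n : U ^+ p = 0 -> (p <= n)%N -> U ^+ n = 0.
Proof. by move=> U0 pn; rewrite -(subnK pn) exprD U0 mulr0. Qed.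

Let hom_pure t : AEhom (AEt_pure t 1) = M t.
Proof.
rewrite /AEhom; case: (reducesP t) => [[i [_ _ ei ti]]|[t12 tn]].
  rewrite (bigD1 i) //= big1 => [|j /negPf ji]; rewrite ffunE ti /= ?eqxx; last first.
    by rewrite ji scale0r.
  case: ei => -> -> ->; rewrite scale1r addr0; congr (_ * _).
  by rewrite expr_mod.
rewrite big1 => [|i _]; last by rewrite ffunE tn scale0r.
by rewrite /M; case/orP: t12 => /exp_ge-> //; rewrite ?mulr0 ?mul0r.
Qed.

Let MM s t : M s * M t = twist s t *: M (addexp s t).
Proof.
have ZX : Z * X = (q ^+ 2)^-1 *: (X * Z) by rewrite XZ scalerA mulVf ?scale1r ?expf_neq0.
have ZY : Z * Y = (q ^+ 2)^-1 *: (Y * Z) by rewrite YZ scalerA mulVf ?scale1r ?expf_neq0.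
case: s t => [[a b] c] [[a' b'] c']; rewrite /M /twist /addexp /=.
rewrite -!mulrA (mulrA (Z ^+ c)) (qcommX c a' ZX) -!scalerAl -!scalerAr.
rewrite -!mulrA (mulrA (Z ^+ c)) (qcommX c b' ZY) -!scalerAl -!scalerAr -!mulrA.
rewrite (mulrA (Y ^+ b)) (qcommX b a' YX) -!scalerAl -!scalerAr !scalerA.
rewrite (exprD X) (exprD Y) (exprD Z) !mulrA; congr (_ *: _).
rewrite !exprVn -!exprM !mulnDr !exprD; field.
by rewrite !expf_neq0.
Qed.

Let homD : {morph AEhom : x y / x + y}.
Proof.
by move=> x y; rewrite -big_split; apply: eq_bigr => i _; rewrite ffunE scalerDl.
Qed.
Let homZ a : {morph AEhom : x / a *: x}.
Proof.
move=> x; rewrite /AEhom scaler_sumr; apply: eq_bigr => i _.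
by rewrite ffunE scalerA.
Qed.
Let hom0 : AEhom 0 = 0. Proof. by rewrite -(scale0r (0 : AE)) homZ scale0r. Qed.
Let hom_mon i : AEhom (AEmon i) = M (expo i). Proof. by rewrite /AEmon monE hom_pure. Qed.

Lemma AEhom1 : AEhom 1 = 1.
Proof. by rewrite [1]/(AEt_pure (0,0,0)%N 1 : AE) hom_pure /M /= !expr0 !mulr1. Qed.

Lemma AEhomM : {morph AEhom : x y / x * y}.
Proof.
move=> x y; rewrite [in LHS](AEmon_decomp x) mulr_suml (big_morph _ homD hom0).
rewrite [in RHS]/AEhom mulr_suml; apply: eq_bigr => i _.
rewrite [in LHS](AEmon_decomp y) mulr_sumr (big_morph _ homD hom0).
rewrite mulr_sumr; apply: eq_bigr => j _.
rewrite -!scalerAl -!scalerAr !homZ; congr (_ *: (_ *: _)).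
by rewrite /AEmon !monE pureM homZ hom_pure -MM.
Qed.

Lemma AEhom_linear (a : K) : {morph AEhom : x y / a *: x + y}.
Proof. by move=> x y; rewrite homD homZ. Qed.

Lemma AEhom_gen : [/\ AEhom etaP = X, AEhom etaM = Y & AEhom delta = Z].
Proof. by split; rewrite hom_pure /M /= !expr0 !expr1 ?mulr1 ?mul1r. Qed.

End Presentation.

(* A(E(1,1|p)) (x) A(E(1,1|p)), the coordinates giving the first leg *)
Definition AE2 : algType K := AEt hq AE.

Definition tens (a b : AE) : AE2 := [ffun i => a i *: b].

Lemma tensM a b c d : tens a b * tens c d = tens (a * c) (b * d).
Proof.
apply: AEtP => l; rewrite [RHS]ffunE.
rewrite [tens a b * _]/(AEt_mul (tens a b) (tens c d)) [a * c]/(AEt_mul a c).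
rewrite !sum_ffunE scaler_suml; apply: eq_bigr => i _.
rewrite !sum_ffunE scaler_suml; apply: eq_bigr => j _; rewrite !ffunE.
case: ifP => _; last by rewrite !scaler0 scale0r.
by rewrite -scalerAl -scalerAr !scalerA; congr (_ *: _).
Qed.

Lemma tens11 : tens 1 1 = 1.
Proof.
by apply: AEtP => l; rewrite !ffunE; case: ifP => _; rewrite ?scale1r ?scale0r.
Qed.

Lemma tensX a b n : tens a b ^+ n = tens (a ^+ n) (b ^+ n).
Proof. by elim: n => [|n IH]; rewrite ?expr0 ?tens11// !exprS IH tensM. Qed.

Lemma tensZl k a b : tens (k *: a) b = k *: tens a b.
Proof. by apply: AEtP => l; rewrite !ffunE scalerA. Qed.
Lemma tensZr k a b : tens a (k *: b) = k *: tens a b.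
Proof. by apply: AEtP => l; rewrite !ffunE !scalerA mulrC. Qed.
Lemma tens0l b : tens 0 b = 0.
Proof. by apply: AEtP => l; rewrite !ffunE scale0r. Qed.
Lemma tens0r a : tens a 0 = 0.
Proof. by apply: AEtP => l; rewrite !ffunE scaler0. Qed.

Definition Delta_etaP : AE2 := tens etaP 1 + tens delta etaP.
Definition Delta_etaM : AE2 := tens etaM 1 + tens deltaV etaM.
Definition Delta_delta : AE2 := tens delta delta.
(* The coproduct of A(E(1,1|p)), spelled out on the monomial basis; DeltaAM shows
   that it is multiplicative. *)
Definition DeltaA (x : AE) : AE2 :=
  \sum_i x i *: (Delta_etaP ^+ i.1.1 * Delta_etaM ^+ i.1.2 * Delta_delta ^+ i.2).

(* q-binomial theorem at a root of unity *)
Lemma qcomm_expp (D : algType K) (X Y : D) (w : K) :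
  p.-primitive_root w -> Y * X = w *: (X * Y) -> (X + Y) ^+ p = X ^+ p + Y ^+ p.
Proof.
move=> hw YX.
pose fix c (n k : nat) {struct n} : K :=
  match n, k with
  | 0, 0 => 1 | 0, _.+1 => 0
  | n'.+1, 0 => 1 | n'.+1, k'.+1 => c n' k' + w ^+ k'.+1 * c n' k'.+1 end.
have c0 n : c n 0%N = 1 by case: n.
have cge n k : (n < k)%N -> c n k = 0.
  elim: n k => [|n IH] [|k] //= nk; rewrite !IH ?mulr0 ?addr0 //; first exact: ltnW.
have cnn n : c n n = 1.
  by elim: n => //= n ->; rewrite cge ?mulr0 ?addr0.
have binom n : (X + Y) ^+ n = \sum_(k < n.+1) c n k *: (X ^+ k * Y ^+ (n - k)).
  elim: n => [|n IH]; first by rewrite big_ord1 /= !expr0 mulr1 scale1r.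
  have XS : X * (X + Y) ^+ n = \sum_(k < n.+1) c n k *: (X ^+ k.+1 * Y ^+ (n - k)).
    rewrite IH mulr_sumr; apply: eq_bigr => k _.
    by rewrite -scalerAr mulrA -exprS.
  have YS : Y * (X + Y) ^+ n = \sum_(k < n.+1) (w ^+ k * c n k) *: (X ^+ k * Y ^+ (n.+1 - k)).
    rewrite IH mulr_sumr; apply: eq_bigr => k _.
    have := qcommX 1 k YX; rewrite !expr1 mul1n => h.
    by rewrite -scalerAr mulrA h -scalerAl scalerA mulrC -mulrA -exprS subSn // -ltnS.
  rewrite exprS mulrDl XS YS [X in _ + X]big_ord_recl [RHS]big_ord_recl /= !c0 expr0 mul1r !subn0.
  rewrite addrCA; congr (_ + _).
  have -> : \sum_(i < n) (w ^+ bump 0 i * c n (bump 0 i)) *: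
        (X ^+ bump 0 i * Y ^+ (n.+1 - bump 0 i)) =
      \sum_(i < n.+1) (w ^+ i.+1 * c n i.+1) *: (X ^+ i.+1 * Y ^+ (n - i)).
    by rewrite [RHS]big_ord_recr /= cge // mulr0 scale0r addr0.
  rewrite -big_split; apply: eq_bigr => k _ /=.
  by rewrite -scalerDl.
have cprod n k : c n k * \prod_(j < k) (w ^+ j.+1 - 1) = \prod_(j < k) (w ^+ (n - j) - 1).
  elim: n k => [|n IH] [|k]; rewrite ?big_ord0 ?c0 ?mulr1 //.
    by rewrite [RHS]big_ord_recl /= subn0 expr0 subrr !mul0r.
  rewrite /= mulrDl [in RHS]big_ord_recl subn0.
  rewrite -[w ^+ k.+1 * _ * _]mulrA IH [in RHS](eq_bigr (fun j : 'I_k => w ^+ (n - j) - 1)) //.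
  rewrite !big_ord_recr /= mulrA IH.
  case: (leqP k n) => kn.
    have -> : w ^+ n.+1 = w ^+ k.+1 * w ^+ (n - k) by rewrite -exprD addSn subnKC.
    ring.
  rewrite [\prod_(_ < _) _](bigD1 (Ordinal kn)) //= subnn expr0 subrr.
  by rewrite !(mul0r, mulr0) addr0.
have w1 k : (0 < k < p)%N -> w ^+ k - 1 != 0.
  case/andP=> k0 kp; rewrite subr_eq0 -(prim_order_dvd hw).
  by rewrite gtnNdvd.
have cp k : (0 < k < p)%N -> c p k = 0.
  case/andP=> k0 kp; have := cprod p k.
  rewrite (_ : \prod_(j < k) (w ^+ (p - j) - 1) = 0); last first.
    case: k k0 kp => // k _ _; rewrite big_ord_recl subn0 (prim_expr_order hw).
    by rewrite subrr mul0r.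
  move/eqP; rewrite mulf_eq0 => /orP[/eqP //|/prodf_eq0[j _]].
  by rewrite (negPf (w1 _ _)) //= (leq_ltn_trans _ kp).
rewrite binom big_ord_recr /= cnn subnn expr0 mulr1 scale1r addrC; congr (_ + _).
rewrite (bigD1 (Ordinal p_gt0)) //= c0 subn0 expr0 mul1r scale1r big1 ?addr0 // => k.
rewrite -val_eqE /= -lt0n => k0; rewrite cp ?scale0r // k0 /=.
exact: ltn_ord.
Qed.

Definition qnum (n : nat) : K := (q ^+ n - q ^- n) / (q - q^-1).
Definition qfact (n : nat) : K := \prod_(1 <= j < n.+1) qnum j.

Definition BP : AE2 := (-1) ^+ (p.+1)./2 *: \sum_(1 <= n < p)
  (q ^+ (n ^ 2) / (qfact (p - n) * qfact n)) *:
  tens (etaP ^+ (p - n) * delta ^+ n) (etaP ^+ n).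
Definition BM : AE2 := (-1) ^+ (p.+1)./2 *: \sum_(1 <= n < p)
  (q ^- (n ^ 2) / (qfact (p - n) * qfact n)) *:
  tens (etaM ^+ (p - n) * deltaV ^+ n) (etaM ^+ n).

(* The integral I on A(E(1,1|p)), extended linearly from the basis. *)
Definition IA (x : AE) : K := \sum_(i : AEidx)
  x i * (q^-1 * (i.1.1 == p.-1 :> nat)%:R * (i.1.2 == p.-1 :> nat)%:R
              * (i.2 == 0 %[mod p])%N%:R).

Section Coproduct.
Hypothesis podd : odd p.

Lemma prim_q2 : p.-primitive_root (q ^+ 2).
Proof. by rewrite prim_root_exp_coprime // coprime2n. Qed.

Let deltaVE : deltaV * delta = 1.
Proof. by rewrite -exprSr prednK // delta_expp. Qed.
Let deltaVE' : delta * deltaV = 1.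
Proof. by rewrite -exprS prednK // delta_expp. Qed.
Let q2 : q ^+ 2 != 0. Proof. exact: expf_neq0. Qed.

Let etaP_deltaV : deltaV * etaP = q ^+ 2 *: (etaP * deltaV).
Proof.
rewrite -[deltaV * etaP]mulr1 -deltaVE' mulrA -(mulrA deltaV) etaP_delta.
by rewrite -scalerAr -scalerAl (mulrA deltaV) deltaVE mul1r.
Qed.
Let etaM_deltaV : deltaV * etaM = q ^+ 2 *: (etaM * deltaV).
Proof.
rewrite -[deltaV * etaM]mulr1 -deltaVE' mulrA -(mulrA deltaV) etaM_delta.
by rewrite -scalerAr -scalerAl (mulrA deltaV) deltaVE mul1r.
Qed.

Let scaled_commD (D : algType K) (c : K) (X1 X2 Y : D) :
  Y * X1 = c *: (X1 * Y) -> Y * X2 = c *: (X2 * Y) ->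
  Y * (X1 + X2) = c *: ((X1 + X2) * Y).
Proof. by move=> h1 h2; rewrite mulrDr h1 h2 mulrDl scalerDr. Qed.
Let scaled_commDl (D : algType K) (c : K) (X Y1 Y2 : D) :
  Y1 * X = c *: (X * Y1) -> Y2 * X = c *: (X * Y2) ->
  (Y1 + Y2) * X = c *: (X * (Y1 + Y2)).
Proof. by move=> h1 h2; rewrite mulrDl h1 h2 mulrDr scalerDr. Qed.
Let tens_comm a b c d k l m : a * c = k *: (c * a) -> b * d = l *: (d * b) ->
  k * l = m -> tens a b * tens c d = m *: (tens c d * tens a b).
Proof. by move=> h1 h2 <-; rewrite !tensM h1 h2 tensZl tensZr scalerA. Qed.
Let comm1 (x y : AE) : x * y = y * x -> x * y = 1 *: (y * x).
Proof. by move=> ->; rewrite scale1r. Qed.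
Let comm11 (x : AE) : x * 1 = 1 *: (1 * x).
Proof. by rewrite mulr1 mul1r scale1r. Qed.
Let comm12 (x : AE) : 1 * x = 1 *: (x * 1).
Proof. by rewrite mulr1 mul1r scale1r. Qed.

Lemma Delta_etaMP : Delta_etaM * Delta_etaP = q ^+ 2 *: (Delta_etaP * Delta_etaM).
Proof.
have h11 := tens_comm etaMP (comm11 1) (mulr1 (q ^+ 2)).
have h12 := tens_comm etaM_delta (comm12 etaP) (mulr1 (q ^+ 2)).
have h21 := tens_comm etaP_deltaV (comm11 etaM) (mulr1 (q ^+ 2)).
have h22 := tens_comm (comm1 (etrans deltaVE (esym deltaVE'))) etaMP (mul1r (q ^+ 2)).
exact: scaled_commD (scaled_commDl h11 h21) (scaled_commDl h12 h22).
Qed.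
Lemma Delta_etaP_delta : Delta_etaP * Delta_delta = q ^+ 2 *: (Delta_delta * Delta_etaP).
Proof.
have h1 := tens_comm etaP_delta (comm12 delta) (mulr1 (q ^+ 2)).
have h2 := tens_comm (comm1 (erefl (delta * delta))) etaP_delta (mul1r (q ^+ 2)).
exact: scaled_commDl h1 h2.
Qed.
Lemma Delta_etaM_delta : Delta_etaM * Delta_delta = q ^+ 2 *: (Delta_delta * Delta_etaM).
Proof.
have h1 := tens_comm etaM_delta (comm12 delta) (mulr1 (q ^+ 2)).
have h2 := tens_comm (comm1 (etrans deltaVE (esym deltaVE'))) etaM_delta (mul1r (q ^+ 2)).
exact: scaled_commDl h1 h2.
Qed.
Lemma Delta_delta_expp : Delta_delta ^+ p = 1.
Proof. by rewrite tensX delta_expp tens11. Qed.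

Lemma Delta_etaP_expp : Delta_etaP ^+ p = 0.
Proof.
have h : p.-primitive_root (q ^+ 2)^-1.
  have -> : (q ^+ 2)^-1 = (q ^+ 2) ^+ p.-1.
    apply: (mulfI q2); rewrite divff // -exprS prednK //.
    by rewrite (prim_expr_order prim_q2).
  rewrite (prim_root_exp_coprime _ prim_q2).
  by rewrite coprime_sym -[X in coprime X _](prednK p_gt0) coprimeSn.
have dP : delta * etaP = (q ^+ 2)^-1 *: (etaP * delta).
  by rewrite etaP_delta scalerA mulVf // scale1r.
have c := tens_comm dP (comm11 etaP) (mulr1 _).
by rewrite /Delta_etaP (qcomm_expp h c) !tensX etaP_expp tens0l tens0r addr0.
Qed.
Lemma Delta_etaM_expp : Delta_etaM ^+ p = 0.
Proof.
have c := tens_comm etaM_deltaV (comm11 etaM) (mulr1 _).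
by rewrite /Delta_etaM (qcomm_expp prim_q2 c) !tensX etaM_expp tens0l tens0r addr0.
Qed.

Lemma DeltaAM : {morph DeltaA : x y / x * y}.
Proof.
exact: (AEhomM Delta_etaMP Delta_etaP_delta Delta_etaM_delta Delta_delta_expp
  Delta_etaP_expp Delta_etaM_expp).
Qed.
Lemma DeltaA1 : DeltaA 1 = 1.
Proof.
exact: (AEhom1 Delta_delta_expp Delta_etaP_expp Delta_etaM_expp).
Qed.

End Coproduct.

Lemma DeltaA_linear (a : K) : {morph DeltaA : x y / a *: x + y}.
Proof. exact: (AEhom_linear Delta_etaP Delta_etaM Delta_delta). Qed.
Lemma DeltaA_mon i : DeltaA (AEmon i) =
  Delta_etaP ^+ i.1.1 * Delta_etaM ^+ i.1.2 * Delta_delta ^+ i.2.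
Proof.
rewrite /DeltaA (bigD1 i) //= AEmonE eqxx scale1r big1 ?addr0 // => j /negPf ji.
by rewrite AEmonE eq_sym ji scale0r.
Qed.
Lemma DeltaA_decomp (x : AE) : \sum_i x i *: DeltaA (AEmon i) = DeltaA x.
Proof. by under eq_bigr do rewrite DeltaA_mon. Qed.

End Algebra.

Section Calculus.
Variable R : realType.
Local Notation C := R[i].
Local Notation plane := (R * R)%type.

Definition ePlus : plane := (1, 0).
Definition eMinus : plane := (0, 1).

(* g has continuous iterated partial derivatives up to order k *)
Fixpoint Ck (k : nat) (g : plane -> R) : Prop :=
  match k with
  | 0 => continuous g
  | k'.+1 => continuous g /\ forall v, v = ePlus \/ v = eMinus ->
      (forall z, derivable g z v) /\ Ck k' ('D_v g)
  end.

Definition Csmooth (f : plane -> C) : Prop := forall k,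
  Ck k (fun z => complex.Re (f z)) /\ Ck k (fun z => complex.Im (f z)).

Definition Csmooth_c (f : plane -> C) : Prop :=
  Csmooth f /\ compact (closure [set z | f z != 0]).

Definition Cderive (v : plane) (f : plane -> C) (z : plane) : C :=
  Complex ('D_v (fun w => complex.Re (f w)) z) ('D_v (fun w => complex.Im (f w)) z).

Definition IC (f : plane -> C) : C :=
  let mu := (@lebesgue_measure R \x @lebesgue_measure R)%E in
  Complex (\int[mu]_z complex.Re (f z)) (\int[mu]_z complex.Im (f z)).

Let Cis_derive (z v : plane) (f : plane -> C) (df : C) :=
  is_derive z v (fun w => complex.Re (f w)) (complex.Re df) /\
  is_derive z v (fun w => complex.Im (f w)) (complex.Im df).

Let Cis_deriveE z v f df : Cis_derive z v f df -> Cderive v f z = df.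
Proof. by case: df => a b [/= h1 h2]; rewrite /Cderive !derive_val. Qed.

Let Cis_derive_sum (I : Type) (s : seq I) (c : I -> C) f (df : I -> C) z v :
  (forall k, Cis_derive z v (f k) (df k)) ->
  Cis_derive z v (fun w => \sum_(k <- s) c k * f k w) (\sum_(k <- s) c k * df k).
Proof.
move=> h; elim: s => [|k s [IH1 IH2]].
  rewrite big_nil; split => /=.
    by rewrite (_ : (fun w => _) = cst 0); [exact: is_derive_cst|apply/funext => w; rewrite big_nil].
  by rewrite (_ : (fun w => _) = cst 0); [exact: is_derive_cst|apply/funext => w; rewrite big_nil].
have [h1 h2] := h k; rewrite big_cons; split.
  rewrite (_ : (fun w => _) = complex.Re (c k) \*: (fun w => complex.Re (f k w))
    - complex.Im (c k) \*: (fun w => complex.Im (f k w))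
    + (fun w => complex.Re (\sum_(k <- s) c k * f k w))); last first.
    apply/funext => w; rewrite big_cons !fctE /=.
    case: (c k) (f k w) (\sum_(_ <- _) _) => [? ?] [? ?] [? ?]; exact: erefl.
  apply: (@is_derive_eq R plane R _ z v).
  by case: (c k) (df k) (\sum_(_ <- _) _) => [? ?] [? ?] [? ?].
rewrite (_ : (fun w => _) = complex.Re (c k) \*: (fun w => complex.Im (f k w))
  + complex.Im (c k) \*: (fun w => complex.Re (f k w))
  + (fun w => complex.Im (\sum_(k <- s) c k * f k w))); last first.
  apply/funext => w; rewrite big_cons !fctE /=.
  by case: (c k) (f k w) (\sum_(_ <- _) _) => [? ?] [? ?] [? ?].
apply: is_derive_eq.
by case: (c k) (df k) (\sum_(_ <- _) _) => [? ?] [? ?] [? ?].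
Qed.

Let smooth_derive f z v : Csmooth f -> v = ePlus \/ v = eMinus ->
  Cis_derive z v f (Cderive v f z).
Proof.
move=> /(_ 1)[[_ hR] [_ hI]] hv; split; apply/derivableP.
  exact: (proj1 (hR v hv)).
exact: (proj1 (hI v hv)).
Qed.

Let smooth_Cderive f v : Csmooth f -> v = ePlus \/ v = eMinus ->
  Csmooth (Cderive v f).
Proof.
move=> hf hv k; have [[_ hR] [_ hI]] := hf k.+1; split.
  exact: (proj2 (hR v hv)).
exact: (proj2 (hI v hv)).
Qed.

Lemma Cderive_sum n (c : 'I_n -> C) (f : 'I_n -> plane -> C) v :
  (forall k, Csmooth (f k)) -> v = ePlus \/ v = eMinus ->
  Cderive v (fun w => \sum_k c k * f k w) = (fun w => \sum_k c k * Cderive v (f k) w).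
Proof.
move=> hf hv; apply/funext => z; apply: Cis_deriveE; apply: Cis_derive_sum => k.
exact: smooth_derive.
Qed.

Lemma Cderive2_sum n (c : 'I_n -> C) (f : 'I_n -> plane -> C) :
  (forall k, Csmooth (f k)) ->
  Cderive ePlus (Cderive eMinus (fun w => \sum_k c k * f k w)) =
  (fun w => \sum_k c k * Cderive ePlus (Cderive eMinus (f k)) w).
Proof.
move=> hf; rewrite Cderive_sum //; last by right.
by rewrite Cderive_sum //; [move=> k; apply: smooth_Cderive => //; right|left].
Qed.

End Calculus.

Section QuantumPoincare.
Variables (R : realType) (p : nat) (q : R[i]) (hq : p.-primitive_root q).
Local Notation C := R[i].
Local Notation plane := (R * R)%type.
Local Notation A := (AE hq).
Local Notation A2 := (AE2 hq).

(* Elements of C^oo(R^2) (x) A(E(1,1|p)) are A(E(1,1|p))-valued functions on the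
   plane. *)
Definition inA0 (F : plane -> A) : Prop :=
  exists (n : nat) (a : 'I_n -> A) (f : 'I_n -> plane -> C),
    (forall k, Csmooth_c (f k)) /\ F = (fun z => \sum_k f k z *: a k).

Definition DeltaC (f : plane -> C) (z' z'' : plane) : A2 :=
  f (z' + z'') *: 1
  + Cderive (ePlus R) f (z' + z'') *: BP hq
  + Cderive (eMinus R) f (z' + z'') *: BM hq
  + Cderive (ePlus R) (Cderive (eMinus R) f) (z' + z'') *: (BP hq * BM hq).

(* F is the sum over i of (basis monomial i) (i-th coordinate of F), and Delta
   is multiplicative and linear; see Delta_sum. *)
Definition Delta (F : plane -> A) (z' z'' : plane) : A2 :=
  \sum_i DeltaA (AEmon hq i) * DeltaC (fun z => F z i) z' z''.

Let sum_lincomb (V : lmodType C) n (c u1 u2 u3 u4 : 'I_n -> C) (v1 v2 v3 v4 : V) :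
  (\sum_k c k * u1 k) *: v1 + (\sum_k c k * u2 k) *: v2
    + (\sum_k c k * u3 k) *: v3 + (\sum_k c k * u4 k) *: v4 =
  \sum_k c k *: (u1 k *: v1 + u2 k *: v2 + u3 k *: v3 + u4 k *: v4).
Proof.
rewrite !scaler_suml -!big_split; apply: eq_bigr => k _ /=.
by rewrite !scalerDr !scalerA.
Qed.

Let sum_mul (D : algType C) (I : finType) n (c : 'I_n -> I -> C) (x : I -> D)
    (y : 'I_n -> D) :
  \sum_i x i * (\sum_k c k i *: y k) = \sum_k (\sum_i c k i *: x i) * y k.
Proof.
under eq_bigr do rewrite mulr_sumr.
rewrite exchange_big; apply: eq_bigr => k _; rewrite mulr_suml.
by apply: eq_bigr => i _; rewrite -scalerAr -scalerAl.
Qed.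

Let DeltaC_sum n (c : 'I_n -> C) (f : 'I_n -> plane -> C) z' z'' :
  (forall k, Csmooth (f k)) ->
  DeltaC (fun z => \sum_k c k * f k z) z' z'' = \sum_k c k *: DeltaC (f k) z' z''.
Proof.
move=> hf; rewrite /DeltaC Cderive2_sum // (Cderive_sum _ hf); last by left.
rewrite (Cderive_sum _ hf); last by right.
exact: sum_lincomb.
Qed.

Lemma Delta_sum n (a : 'I_n -> A) (f : 'I_n -> plane -> C) :
  (forall k, Csmooth (f k)) ->
  Delta (fun z => \sum_k f k z *: a k) =
  (fun z' z'' => \sum_k DeltaA (a k) * DeltaC (f k) z' z'').
Proof.
move=> hf; apply/funext => z'; apply/funext => z''; rewrite /Delta.
have coordE i : (fun z => (\sum_k f k z *: a k) i) = (fun z => \sum_k a k i * f k z).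
  apply/funext => z; rewrite sum_ffunE; apply: eq_bigr => k _.
  by rewrite ffunE; exact: mulrC.
under eq_bigr => i _ do rewrite coordE DeltaC_sum //.
rewrite (sum_mul (fun k i => a k i) _ (fun k => DeltaC (f k) z' z'')).
by apply: eq_bigr => k _; rewrite DeltaA_decomp.
Qed.

Definition IE (F : plane -> A) : C :=
  \sum_i IA (AEmon hq i) * IC (fun z => F z i).

Definition id_tensor (phi : (plane -> A) -> C) (G : plane -> plane -> A2)
    (z' : plane) : A :=
  \sum_i phi (fun z'' => G z' z'' i) *: AEmon hq i.

Definition tensor_id (phi : (plane -> A) -> C) (G : plane -> plane -> A2)
    (z'' : plane) : A :=
  \sum_j phi (fun z' => \sum_i G z' z'' i j *: AEmon hq i) *: AEmon hq j.

(* A functional on A_0 is a functional on all A(E(1,1|p))-valued functions of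
   which only the values on A_0 are constrained. *)
Definition linear_on_A0 (phi : (plane -> A) -> C) : Prop :=
  forall (c : C) (F G : plane -> A), inA0 F -> inA0 G ->
    phi (fun z => c *: F z + G z) = c * phi F + phi G.

Definition invariant_integral (phi : (plane -> A) -> C) : Prop :=
  linear_on_A0 phi /\
  forall F, inA0 F ->
    (forall z', id_tensor phi (Delta F) z' = phi F *: 1) /\
    (forall z'', tensor_id phi (Delta F) z'' = phi F *: 1).

End QuantumPoincare.

(* Main.v *)
Require Import Defs.
From mathcomp Require Import all_boot all_order all_algebra.
From mathcomp Require Import complex ring lra.
From mathcomp Require Import all_classical all_reals all_analysis measurable_realfun.

Set Implicit Arguments.
Unset Strict Implicit.
Unset Printing Implicit Defensive.

Import Order.TTheory GRing.Theory Num.Theory.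
Import numFieldNormedType.Exports.

Local Open Scope ring_scope.

(** Invariance: all monomials but [etaP ^+ p.-1 * etaM ^+ p.-1] are killed by [IA], the
    coproduct of A(E(1,1|p)) is expanded with the q-binomial formula, and the terms of
    [Delta f] containing [B_+] or [B_-] carry a derivative of [f], whose integral vanishes.

    Uniqueness uses only left invariance at [z' = 0].  Total bidegree in [etaP], [etaM] kills
    every product with [B_+] ([B_-]) when the bidegree in [etaP] ([etaM]) is already [p - 1].
    So for the monomials of bidegree [(p - 1, p - 1)] single coordinates of the invariance
    identity show that phi vanishes on all [mon f] except for the top monomial; and for
    [etaM ^+ p.-1] and [etaP ^+ p.-1] they show that phi vanishes on [top * d_+ f] and
    [top * d_- f].  A functional on test functions killing all partial derivatives is a
    multiple of the integral: integrating out one variable at a time,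
    [f = d_+ G + d_- H + (integral of f) w] for a fixed test function [w]. *)

(** An identity read off in one coordinate is useful only if its coefficient is invertible. As p is
    odd, q^2 is again a primitive p-th root of unity, so the q-binomial coefficients of order below
    p and the factorials in B_+ and B_- are nonzero. For the top monomial itself such an identity is
    trivial, because the matching first leg is the unit. Information about it has to come from a
    monomial lacking one of the two etas: the term n = p - 1 of B_+ or B_- then supplies the missing
    power p - 1 in the second leg, and with it a derivative of f. On the analytic side, smoothness
    is given through iterated partial derivatives. All integrals are therefore taken along lines
    parallel to the axes and kept as functions on the plane, so that one-variable calculus and
    differentiation under the integral suffice. Fubini enters once, to identify the iterated
    integral with [IC]. *)

(** * Calculus on the real line for functions of bounded support *)

Section Line.
Local Open Scope classical_set_scope.
Variable R : realType.
Local Notation mu := (@lebesgue_measure R).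

(** The two difference quotients are the same function of the increment. This replaces the chain
    rule, since [Ck] directly gives only partial derivatives and not Fréchet differentiability. *)
Lemma is_derive_line (V : normedModType R) (g : V -> R) (z v : V) (s : R) :
  derivable g (z + s *: v) v ->
  is_derive s 1 (fun t : R => g (z + t *: v)) ('D_v g (z + s *: v)).
Proof.
have E : (fun h : R => h^-1 *: (((fun t : R => g (z + t *: v)) \o shift s) (h *: 1)
      - g (z + s *: v))) =
    (fun h : R => h^-1 *: ((g \o shift (z + s *: v)) (h *: v) - g (z + s *: v))).
  by apply/funext => h /=; rewrite [h *: 1]mulr1 scalerDl addrCA.
by move=> dg; apply: DeriveDef; rewrite /derivable /derive E.
Qed.

Lemma Rintegral_bounded_support (D : set R) (phi : R -> R) (L : R) :
  (forall s, L < `|s| -> phi s = 0) ->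
  \int[mu]_(s in D) phi s = \int[mu]_(s in D `&` `[- L, L]) phi s.
Proof.
move=> phi0; rewrite Rintegral_mkcondr; apply: eq_Rintegral => s _.
rewrite patchE; case: ifPn => // /negP h; apply: phi0; rewrite ltNge.
by apply/negP => sL; apply: h; rewrite inE /= in_itv /= -ler_norml.
Qed.

Lemma integrable_bounded_support (phi : R -> R) (L : R) (D : set R) :
  measurable D -> continuous phi -> (forall s, L < `|s| -> phi s = 0) ->
  mu.-integrable D (EFin \o phi).
Proof.
move=> mD cphi phi0; apply: (@integrableS _ _ _ _ setT) => //.
have -> : EFin \o phi = (EFin \o phi) \_ `[- L, L].
  apply/funext => s; rewrite patchE; case: ifPn => // /negP h /=.
  rewrite phi0 // ltNge; apply/negP => sL; apply: h.
  by rewrite inE /= in_itv /= -ler_norml.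
apply/integrable_restrict => //; rewrite setTI.
apply: continuous_compact_integrable; first exact: segment_compact.
exact: continuous_subspaceT.
Qed.

Section Primitive.
Variables (phi psi : R -> R) (L : R).
Hypotheses (dphi : forall s : R, is_derive s 1 phi (psi s)) (cpsi : continuous psi).
Hypotheses (phi0 : forall s, L < `|s| -> phi s = 0) (psi0 : forall s, L < `|s| -> psi s = 0).

Let cphi : continuous phi.
Proof.
move=> s; apply/differentiable_continuous/derivable1_diffP.
exact: (@ex_derive _ _ _ _ _ _ _ (dphi s)).
Qed.

Let FTC a b : a < b -> \int[mu]_(s in `[a, b]) psi s = phi b - phi a.
Proof.
move=> ab; rewrite /Rintegral (@continuous_FTC2 _ psi phi) //.
- exact: continuous_subspaceT.
- split; last 2 first.
  + exact/cvg_at_right_filter/cphi.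
  + exact/cvg_at_left_filter/cphi.
  by move=> s _; exact: (@ex_derive _ _ _ _ _ _ _ (dphi s)).
by move=> s _; rewrite derive1E (@derive_val _ _ _ _ _ _ _ (dphi s)).
Qed.

Lemma Rintegral_derive_itvNy x : \int[mu]_(s in `]-oo, x]) psi s = phi x.
Proof.
(* [M] exceeds [L] and the absolute value of [x]: hence [phi (- M)] vanishes and [x] lies strictly
   to the right of [- M]. *)
pose M := `|L| + `|x| + 1.
have LM : L < M by rewrite /M; have := ler_norm L; have := normr_ge0 x; lra.
have xM : `|x| < M by rewrite /M; have := normr_ge0 L; lra.
rewrite (@Rintegral_bounded_support _ _ M) => [|s Ms]; last first.
  by apply: psi0; exact: lt_trans Ms.
rewrite (_ : _ `&` _ = `[- M, x]); last first.
  move: xM; rewrite ltr_norml => /andP[h1 h2].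
  apply/seteqP; split=> s /=; rewrite !in_itv /=; first by case=> -> /andP[->].
  by move=> /andP[-> sx]; split=> //=; rewrite (le_trans sx) // ltW.
rewrite FTC; last by move: xM; rewrite ltr_norml => /andP[].
rewrite [phi (- M)]phi0 ?subr0 // normrN ger0_norm //.
by rewrite (le_trans _ (ltW xM)).
Qed.

Lemma Rintegral_deriveT : \int[mu]_s psi s = 0.
Proof.
pose M := `|L| + 1.
have LM : L < M by rewrite /M; have := ler_norm L; lra.
have M0 : 0 < M by rewrite /M; have := normr_ge0 L; lra.
rewrite (@Rintegral_bounded_support _ _ M) => [|s Ms]; last first.
  by apply: psi0; exact: lt_trans Ms.
rewrite setTI FTC; last by lra.
by rewrite !phi0 ?subr0 // ?normrN ger0_norm // ltW.
Qed.
End Primitive.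

(** By continuity [phi] stays above [phi x0 / 2] on a segment around [x0], and the integral
    dominates that of this constant over the segment. *)
Lemma Rintegral_gt0 (phi : R -> R) (L x0 : R) : continuous phi ->
  (forall s, L < `|s| -> phi s = 0) -> (forall s, 0 <= phi s) -> 0 < phi x0 ->
  0 < \int[mu]_s phi s.
Proof.
move=> cphi phi0 phi_ge0 px0.
have [e e0 he] : exists2 e, 0 < e & forall s, x0 - e <= s <= x0 + e -> phi x0 / 2 <= phi s.
  have /cvgrPdist_lt /(_ _ (divr_gt0 px0 (ltr0Sn _ 1))) := cphi x0.
  case/nbhs_normP => e /= e0 he; exists (e / 2); first exact: divr_gt0.
  move=> s /andP[s1 s2]; have /he : `|x0 - s| < e by rewrite ltr_norml; lra.
  by rewrite /= ltr_norml => /andP[h1 h2]; lra.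
have int D : measurable D -> mu.-integrable D (EFin \o phi).
  by move=> mD; apply: integrable_bounded_support cphi phi0.
apply: (@lt_le_trans _ _ (\int[mu]_(s in `[x0 - e, x0 + e]) phi s)).
  apply: (@lt_le_trans _ _ (\int[mu]_(s in `[x0 - e, x0 + e]) cst (phi x0 / 2) s)).
    rewrite Rintegral_cst //.
    have /= := lebesgue_measure_itv (`[x0 - e, x0 + e]%R); rewrite lte_fin ifT; last by lra.
    by move=> ->; rewrite -EFinB /= mulr_gt0 //; lra.
  apply: le_Rintegral => //; last by apply: int.
  apply: continuous_compact_integrable; first exact: segment_compact.
  by apply: continuous_subspaceT; exact: cst_continuous.
rewrite [leLHS]Rintegral_mkcond; apply: le_Rintegral => //.
- by rewrite -restrict_EFin; apply/integrable_restrict => //; rewrite setTI; exact: int.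
- by apply: int.
- by move=> s _; rewrite patchE; case: ifP.
Qed.
End Line.

(** * Smooth functions on the plane and their supports, one axis at a time *)

Section Plane.
Local Open Scope classical_set_scope.
Variable R : realType.
Local Notation plane := (R * R)%type.
Local Notation mu := (@lebesgue_measure R).
Implicit Types (b : bool) (g f : plane -> R) (z v w : plane).

(** Indexing the two variables by a boolean turns each pair of symmetric statements into one, with
    [~~ b] as the other variable. *)
Definition axis b : plane := if b then ePlus R else eMinus R.
Definition coord b z : R := if b then z.1 else z.2.

Lemma axisP v : v = ePlus R \/ v = eMinus R <-> exists b, v = axis b.
Proof.
split=> [[->|->]|[[] ->]]; [by exists true|by exists false|by left|by right].
Qed.

Lemma coord_add b z w : coord b (z + w) = coord b z + coord b w.
Proof. by case: b. Qed.

Lemma coord_axis b c (s : R) : coord b (s *: axis c) = if b == c then s else 0.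
Proof.
by case: b c => [] []; rewrite /coord /axis /ePlus /eMinus /= /GRing.scale /= ?mulr1 ?mulr0.
Qed.

Lemma plane_coordP z w : (forall b, coord b z = coord b w) -> z = w.
Proof.
by case: z w => [z1 z2] [w1 w2] h; congr (_, _); [exact: (h true)|exact: (h false)].
Qed.

Lemma coord_continuous b : continuous (coord b).
Proof. by case: b => z; [exact: cvg_fst|exact: cvg_snd]. Qed.

Lemma axis_line_continuous b z : continuous (fun s : R => z + s *: axis b).
Proof.
move=> s; apply: cvgD; first exact: cvg_cst.
by apply: cvgZr_tmp; exact: cvg_id.
Qed.

Definition Rsmooth g := forall k, Ck k g.

Lemma CkS k g : Ck k.+1 g <-> continuous g /\
  forall b, (forall z, derivable g z (axis b)) /\ Ck k ('D_(axis b) g).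
Proof.
split=> [[cg h]|[cg h]]; split=> //.
  by move=> b; apply: h; apply/axisP; exists b.
by move=> v /axisP[b ->]; exact: h.
Qed.

Lemma Ck_le k g : Ck k.+1 g -> Ck k g.
Proof.
elim: k g => [|k IH] g /CkS[cg h] //; apply/CkS; split=> // b.
by have [dg Dg] := h b; split=> //; exact: IH.
Qed.

Lemma Rsmooth_continuous g : Rsmooth g -> continuous g.
Proof. by move/(_ 0%N). Qed.
Lemma Rsmooth_derivable b g z : Rsmooth g -> derivable g z (axis b).
Proof. by move=> /(_ 1%N) /CkS[_ /(_ b)[]]. Qed.
Lemma Rsmooth_derive b g : Rsmooth g -> Rsmooth ('D_(axis b) g).
Proof. by move=> sg k; have /CkS[_ /(_ b)[]] := sg k.+1. Qed.

(** Smooth functions form the largest class of continuous functions stable under partial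
    derivatives, so smoothness can be proved by exhibiting a stable class. *)
Lemma Rsmooth_coind (P : (plane -> R) -> Prop) :
  (forall g, P g -> continuous g /\
     forall b, (forall z, derivable g z (axis b)) /\ P ('D_(axis b) g)) ->
  forall g, P g -> Rsmooth g.
Proof.
move=> hP g Pg k; elim: k g Pg => [|k IH] g /hP[cg h] //; apply/CkS; split=> // b.
by have [dg Pdg] := h b; split=> //; exact: IH.
Qed.

Lemma Rsmooth_cst (c : R) : Rsmooth (cst c).
Proof.
apply: (@Rsmooth_coind (fun g => exists c, g = cst c)); last by exists c.
move=> _ [a ->]; split=> [|b]; first exact: cst_continuous.
split=> [z|]; first exact: derivable_cst.
by exists 0; apply/funext => z; rewrite derive_cst.
Qed.

Lemma CkD k f g : Ck k f -> Ck k g -> Ck k (f + g).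
Proof.
elim: k f g => [|k IH] f g.
  by move=> cf cg z; exact: (continuousD (cf z) (cg z)).
move=> /CkS[cf hf] /CkS[cg hg]; apply/CkS; split=> [z|b].
  exact: (continuousD (cf z) (cg z)).
have [df Df] := hf b; have [dg Dg] := hg b; split=> [z|]; first exact: derivableD.
rewrite (_ : 'D_(axis b) (f + g) = 'D_(axis b) f + 'D_(axis b) g); first exact: IH.
by apply/funext => z; rewrite deriveD.
Qed.

(** The Leibniz rule turns a product into a sum of products, so products alone are not a stable
    class for [Rsmooth_coind]. The induction is on the order, and [Ck_le] lowers the order of the
    factor that is not differentiated. *)
Lemma CkM k f g : Ck k f -> Ck k g -> Ck k (f * g).
Proof.
elim: k f g => [|k IH] f g.
  by move=> cf cg z; exact: (continuousM (cf z) (cg z)).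
move=> Cf Cg; have /CkS[cf hf] := Cf; have /CkS[cg hg] := Cg; apply/CkS.
split=> [z|b]; first exact: (continuousM (cf z) (cg z)).
have [df Df] := hf b; have [dg Dg] := hg b; split=> [z|]; first exact: derivableM.
rewrite (_ : 'D_(axis b) (f * g) = f * 'D_(axis b) g + g * 'D_(axis b) f).
  by apply: CkD; apply: IH => //; exact: Ck_le.
by apply/funext => z; rewrite deriveM.
Qed.

Lemma RsmoothD f g : Rsmooth f -> Rsmooth g -> Rsmooth (f + g).
Proof. by move=> sf sg k; exact: CkD. Qed.
Lemma RsmoothM f g : Rsmooth f -> Rsmooth g -> Rsmooth (f * g).
Proof. by move=> sf sg k; exact: CkM. Qed.
Lemma RsmoothZ (c : R) g : Rsmooth g -> Rsmooth (fun z => c * g z).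
Proof.
move=> sg; rewrite (_ : (fun z => _) = cst c * g) //.
by apply: RsmoothM => //; exact: Rsmooth_cst.
Qed.
Lemma RsmoothB f g : Rsmooth f -> Rsmooth g -> Rsmooth (f - g).
Proof.
move=> sf sg; rewrite (_ : f - g = f + (fun z => -1 * g z)); last first.
  by apply/funext => z; rewrite !fctE mulN1r.
by apply: RsmoothD => //; exact: RsmoothZ.
Qed.

Lemma derivable_shift w g z v : derivable g (w + z) v -> derivable (fun u => g (w + u)) z v.
Proof.
rewrite /derivable (_ : (fun h => _) = (fun h : R => h^-1 *:
   (((fun u => g (w + u)) \o shift z) (h *: v) - g (w + z)))) //.
by apply/funext => h /=; rewrite addrCA.
Qed.

Lemma derive_shift w g v : 'D_v (fun u => g (w + u)) = (fun u => 'D_v g (w + u)).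
Proof.
apply/funext => z; rewrite /derive (_ : (fun h => _) = (fun h : R => h^-1 *:
   ((g \o shift (w + z)) (h *: v) - g (w + z)))) //.
by apply/funext => h /=; rewrite addrCA.
Qed.

Lemma Rsmooth_shift w g : Rsmooth g -> Rsmooth (fun z => g (w + z)).
Proof.
move=> sg; apply: (@Rsmooth_coind (fun f => exists2 g, Rsmooth g & f = fun z => g (w + z)));
  last by exists g.
move=> _ [f sf ->]; split=> [z|b].
  apply: continuous_comp; last exact: Rsmooth_continuous.
  by apply: cvgD; [exact: cvg_cst|exact: cvg_id].
split=> [z|]; first by apply: derivable_shift; exact: Rsmooth_derivable.
by exists ('D_(axis b) f); [exact: Rsmooth_derive|rewrite derive_shift].
Qed.

(** Supports are controlled one variable at a time because a marginal is constant in the variable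
    integrated out and has bounded support only in the other. *)
Definition bounded_along b g := exists M, forall z, M < `|coord b z| -> g z = 0.

(** The strict inequality is an open condition, so [g] vanishes in a neighbourhood of [z] and the
    same bound serves for the derivative. *)
Lemma bounded_along_derive b c g : bounded_along b g -> bounded_along b ('D_(axis c) g).
Proof.
case=> M gM; exists M => z Mz.
rewrite (@near_eq_derive _ _ _ g (cst 0)) ?derive_cst //.
have : `|coord b w| @[w --> z] --> `|coord b z|.
  exact: (cvg_norm (@coord_continuous b z)).
by move/cvgr_gt => /(_ _ Mz); apply: filterS => w; exact: gM.
Qed.

Lemma bounded_alongD b f g : bounded_along b f -> bounded_along b g -> bounded_along b (f + g).
Proof.
case=> M fM [N gN]; exists (Num.max M N) => z; rewrite gt_max => /andP[Mz Nz].
by rewrite !fctE fM // gN // addr0.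
Qed.
Lemma bounded_alongMl b f g : bounded_along b f -> bounded_along b (f * g).
Proof. by case=> M fM; exists M => z Mz; rewrite !fctE fM // mul0r. Qed.
Lemma bounded_alongMr b f g : bounded_along b g -> bounded_along b (f * g).
Proof. by case=> M fM; exists M => z Mz; rewrite !fctE fM // mulr0. Qed.
Lemma bounded_alongZ b (c : R) g : bounded_along b g -> bounded_along b (fun z => c * g z).
Proof. exact: (@bounded_alongMr b (cst c)). Qed.
Lemma bounded_alongB b f g : bounded_along b f -> bounded_along b g -> bounded_along b (f - g).
Proof.
case=> M fM [N gN]; exists (Num.max M N) => z; rewrite gt_max => /andP[Mz Nz].
by rewrite !fctE fM // gN // subr0.
Qed.
Lemma bounded_along_shift b w g : bounded_along b g -> bounded_along b (fun z => g (w + z)).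
Proof.
case=> M gM; exists (M + `|coord b w|) => z Mz; apply: gM.
rewrite coord_add; have := ler_normB (coord b w + coord b z) (coord b w).
by rewrite addrAC subrr add0r; lra.
Qed.

Lemma continuous_bounded_box g (L : R) : continuous g ->
  exists2 C, 0 <= C & forall z, (forall b, `|coord b z| <= L) -> `|g z| <= C.
Proof.
move=> cg; have cK : compact (`[- L, L] `*` `[- L, L] : set plane).
  by apply: compact_setX; exact: segment_compact.
have /compact_bounded[M [_ hM]] := continuous_compact (continuous_subspaceT cg) cK.
exists (`|M| + 1) => [|z hz]; first by rewrite addr_ge0.
apply: (hM (`|M| + 1)); first by have := ler_norm M; lra.
exists z => //; split; rewrite /= in_itv /= -ler_norml.
  exact: (hz true).
exact: (hz false).
Qed.

End Plane.

(** * Integrals along lines parallel to an axis, as functions of the base point *)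

Section LineIntegral.
Local Open Scope classical_set_scope.
Variable R : realType.
Local Notation plane := (R * R)%type.
Local Notation mu := (@lebesgue_measure R).
Implicit Types (b c : bool) (g f : plane -> R) (z v w : plane) (D : set R).

(** The parameter [s] is relative to the base point [z]: [D = setT] gives the marginal, and
    [D = ]-oo, 0]] the primitive in direction [b] that starts at minus infinity and ends at [z]. As
    the result is again a function on the plane, integrations can be iterated. *)
Definition lineint D b g z : R := \int[mu]_(s in D) g (z + s *: axis R b).

Lemma continuous_on_line b g z : continuous g -> continuous (fun s : R => g (z + s *: axis R b)).
Proof.
move=> cg s; apply: continuous_comp; last exact: cg.
exact: axis_line_continuous.
Qed.

Lemma bounded_support_on_line b g : bounded_along b g -> exists M, forall z s,
  M + `|coord b z| < `|s| -> g (z + s *: axis R b) = 0.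
Proof.
case=> M gM; exists M => z s Ms; apply: gM; rewrite coord_add coord_axis eqxx.
have := ler_normB (coord b z + s) (coord b z).
by rewrite addrAC subrr add0r; lra.
Qed.

Lemma integrable_on_line D b g z : measurable D -> continuous g -> bounded_along b g ->
  mu.-integrable D (EFin \o (fun s : R => g (z + s *: axis R b))).
Proof.
move=> mD cg /bounded_support_on_line[M gM].
apply: (@integrable_bounded_support R _ (M + `|coord b z|)) => // [|s].
  exact: continuous_on_line.
exact: gM.
Qed.

Lemma lineintD D b f g : measurable D -> continuous f -> bounded_along b f ->
  continuous g -> bounded_along b g ->
  lineint D b (f + g) = lineint D b f + lineint D b g.
Proof.
move=> mD cf bf cg bg; apply/funext => z; rewrite -[RHS]/(lineint D b f z + lineint D b g z) /lineint -RintegralD //.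
- exact: integrable_on_line.
- exact: integrable_on_line.
Qed.

Lemma lineintM D b f g : measurable D -> continuous f -> bounded_along b f ->
  (forall z s, g (z + s *: axis R b) = g z) ->
  lineint D b (g * f) = g * lineint D b f.
Proof.
move=> mD cf bf gc; apply/funext => z; rewrite -[RHS]/(g z * lineint D b f z) /lineint -RintegralZl //.
  by apply: eq_Rintegral => s _; rewrite -(gc z s).
exact: integrable_on_line.
Qed.

Lemma lineintZ D b f (k : R) : measurable D -> continuous f -> bounded_along b f ->
  lineint D b (fun z => k * f z) = (fun z => k * lineint D b f z).
Proof. by move=> mD cf bf; exact: (@lineintM D b f (cst k)). Qed.

Lemma lineint_shift D b g w z : lineint D b (fun u => g (w + u)) z = lineint D b g (w + z).
Proof. by apply: eq_Rintegral => s _; rewrite addrA. Qed.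

Lemma bounded_along_lineint D b c g : b != c -> bounded_along c g ->
  bounded_along c (lineint D b g).
Proof.
move=> /negPf bc [M gM]; exists M => z Mz.
rewrite /lineint (@eq_Rintegral _ _ _ _ _ (cst 0)) ?Rintegral0 //.
  by rewrite /Rintegral integral0.
by move=> s _; rewrite gM // coord_add coord_axis eq_sym bc addr0.
Qed.

(** For [z] near [z0] all integrands are supported in one segment [[- L, L]], and compactness of
    that segment makes them [d]-close uniformly in [s]. The choice [d = e / (2 * L)] accounts for
    its length. *)
Lemma lineint_continuous D b g : measurable D -> continuous g -> bounded_along b g ->
  continuous (lineint D b g).
Proof.
move=> mD cg bg z0; have [M gM] := bounded_support_on_line bg.
pose L := `|M| + `|coord b z0| + 1.
have L0 : 0 < L by rewrite /L; have := normr_ge0 M; have := normr_ge0 (coord b z0); lra.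
have suppL : \forall z \near z0, forall s, L < `|s| -> g (z + s *: axis R b) = 0.
  have h : `|coord b w| @[w --> z0] --> `|coord b z0|.
    exact: (cvg_norm (@coord_continuous R b z0)).
  have /cvgr_lt /(_ (`|coord b z0| + 1)) := h; rewrite ltrDl ltr01 => /(_ isT).
  apply: filterS => z hz s Ls; apply: gM; move: Ls; rewrite /L.
  by have := ler_norm M; lra.
apply/cvgrPdist_le => e e0; pose d := e / (2 * L).
have d0 : 0 < d by rewrite divr_gt0 // mulr_gt0.
have unif : \forall z \near z0, `[- L, L] `<=`
    [set s | `|g (z0 + s *: axis R b) - g (z + s *: axis R b)| < d].
  have cov : near_covering (`[- L, L] : set R).
    by apply/compact_near_coveringP; exact: segment_compact.
  have := cov plane (nbhs z0)
    (fun z s => `|g (z0 + s *: axis R b) - g (z + s *: axis R b)| < d) _.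
  apply=> s _.
  pose G (u : R * plane) := g (z0 + u.1 *: axis R b) - g (u.2 + u.1 *: axis R b).
  have cG : {for (s, z0), continuous G}.
    apply: cvgB; apply: continuous_comp; try exact: cg.
      apply: cvgD; first exact: cvg_cst.
      by apply: cvgZr_tmp; exact: cvg_fst.
    apply: cvgD; first exact: cvg_snd.
    by apply: cvgZr_tmp; exact: cvg_fst.
  have : \forall u \near (s, z0), `|G u| < d.
    have /cvgrPdist_lt /(_ _ d0) := cG; apply: filterS => u.
    by rewrite [G (s, z0)]subrr sub0r normrN.
  by [].
near=> z.
have hz : forall s, L < `|s| -> g (z + s *: axis R b) = 0 by near: z.
have hz0 : forall s, L < `|s| -> g (z0 + s *: axis R b) = 0 by exact: nbhs_singleton suppL.
have hu : `[- L, L] `<=` [set s | `|g (z0 + s *: axis R b) - g (z + s *: axis R b)| < d].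
  by near: z.
have int z' (E : set R) : measurable E ->
    mu.-integrable E (EFin \o (fun s : R => g (z' + s *: axis R b))).
  by move=> mE; exact: integrable_on_line.
have cdiff : continuous (fun s : R => g (z0 + s *: axis R b) - g (z + s *: axis R b)).
  by move=> s; apply: cvgB; exact: continuous_on_line.
rewrite /lineint -RintegralB //; [|exact: int|exact: int].
rewrite (@Rintegral_bounded_support _ _ _ L); last by move=> s Ls; rewrite hz // hz0 // subrr.
have mDL : measurable (D `&` `[- L, L]) by apply: measurableI.
apply: le_trans.
  apply: le_normr_Rintegral => //; apply: (@integrable_bounded_support R _ L) => // s Ls.
  by rewrite hz // hz0 // subrr.
have mL : measurable (`[- L, L] : set R) by [].
have muL : mu (`[- L, L] : set R) = (2 * L)%:E.
  have /= := lebesgue_measure_itv (`[- L, L]%R); rewrite lte_fin ifT; last by lra.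
  by move=> ->; rewrite -EFinB; congr EFin; lra.
have muDL : (mu (D `&` `[(- L)%R, L]) <= (2 * L)%R%:E)%E.
  by rewrite -muL; apply: le_measure; rewrite ?inE //; exact: subIsetr.
apply: (@le_trans _ _ (\int[mu]_(s in D `&` `[- L, L]) d)).
  apply: le_Rintegral => //; last by move=> s [_ sL]; exact/ltW/hu.
  - apply: (@integrable_bounded_support R _ L) => //.
      by move=> s; apply: cvg_norm; exact: cdiff.
    by move=> s Ls; rewrite hz // hz0 // subrr normr0.
  - apply: measurable_bounded_integrable => //; first exact: le_lt_trans muDL (ltry _).
    exact: bounded_cst.
rewrite Rintegral_cst // (_ : e = d * (2 * L)); last first.
  by rewrite /d divfK // mulf_neq0 // gt_eqF.
rewrite ler_pM2l //; apply: (fine_le _ _ muDL) => //.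
by rewrite ge0_fin_numE // (le_lt_trans muDL (ltry _)).
Unshelve. all: by end_near. Qed.

Lemma lineint_derive D b g z : measurable D -> Rsmooth g -> bounded_along b g ->
  forall c, is_derive z (axis R c) (lineint D b g) (lineint D b ('D_(axis R c) g) z).
Proof.
move=> mD sg bg c; pose f (x s : R) := g (z + s *: axis R b + x *: axis R c).
have fE x s : f x s = g ((z + x *: axis R c) + s *: axis R b) by rewrite /f addrAC.
have Ffun : (fun x : R => \int[mu]_(s in D) f x s) =
    (fun x : R => lineint D b g (z + x *: axis R c)).
  by apply/funext => x; apply: eq_Rintegral => s _; rewrite fE.
have I0 : (`]-1, 1[ : set R) 0 by rewrite /= in_itv /= ltrN10 ltr01.
have intf x : (`]-1, 1[ : set R) x -> mu.-integrable D (EFin \o f x).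
  move=> _; rewrite (_ : f x = (fun s => g ((z + x *: axis R c) + s *: axis R b))).
    by apply: integrable_on_line => //; exact: Rsmooth_continuous.
  by apply/funext => s; exact: fE.
have df (x s : R) : is_derive x 1 (f ^~ s) ('D_(axis R c) g (z + s *: axis R b + x *: axis R c)).
  by apply: is_derive_line; exact: Rsmooth_derivable.
have derf (x s : R) : (`]-1, 1[ : set R) x -> D s -> derivable (f ^~ s) x 1.
  by move=> _ _; exact: (@ex_derive _ _ _ _ _ _ _ (df x s)).
have dfE (x s : R) : partial1of2 f x s = 'D_(axis R c) g (z + s *: axis R b + x *: axis R c).
  by rewrite partial1of2E; exact: (@derive_val _ _ _ _ _ _ _ (df x s)).
have bDg := bounded_along_derive c bg; have [M DgM] := bounded_support_on_line bDg.
have sDg := Rsmooth_derive c sg.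
(* The summand 1 allows for the displacement [x] in []-1, 1[]: outside [[- L, L]] the derivative
   vanishes for all such [x] at once, so a constant times the indicator of this segment
   dominates. *)
pose L := `|M| + `|coord b z| + 1.
have L0 : 0 < L by rewrite /L; have := normr_ge0 M; have := normr_ge0 (coord b z); lra.
have [C C0 hC] := continuous_bounded_box (`|coord true z| + `|coord false z| + L + 1)
  (Rsmooth_continuous sDg).
pose G : R -> R := C \o* \1_(`[- L, L] : set R).
have G0 s : 0 <= G s by rewrite /G /= mulr_ge0.
have intG : mu.-integrable D (EFin \o G).
  apply: (@integrableS _ _ _ _ setT) => //.
  rewrite (_ : EFin \o G = (cst C%:E) \_ (`[- L, L] : set R)).
    apply/integrable_restrict => //; rewrite setTI.
    rewrite (_ : cst C%:E = EFin \o cst C) //.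
    apply: continuous_compact_integrable; first exact: segment_compact.
    by apply: continuous_subspaceT; exact: cst_continuous.
  apply/funext => s; rewrite patchE /G /= indicE.
  by case: ifPn => _; rewrite ?mulr1 ?mul1r ?mulr0 ?mul0r.
have Gub (x s : R) : (`]-1, 1[ : set R) x -> D s -> `|partial1of2 f x s| <= G s.
  rewrite /= in_itv /= => xI _; rewrite dfE.
  have x1 : `|x| < 1 by rewrite ltr_norml.
  have cx d : `|coord d (x *: axis R c)| <= 1.
    by rewrite coord_axis; case: ifP; rewrite ?normr0 // ltW.
  case: (leP `|s| L) => sL.
    rewrite /G /= indicE mem_set; last by rewrite /= in_itv /= -ler_norml.
    rewrite ?mul1r ?mulr1; apply: hC => d; rewrite !coord_add.
    have h1 := cx d; have h2 : `|coord d (s *: axis R b)| <= L.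
      by rewrite coord_axis; case: ifP; rewrite ?normr0 // ltW.
    have h3 : `|coord d z| <= `|coord true z| + `|coord false z|.
      by case: d {h1 h2}; rewrite ?lerDl ?lerDr.
    have := ler_normD (coord d z + coord d (s *: axis R b)) (coord d (x *: axis R c)).
    by have := ler_normD (coord d z) (coord d (s *: axis R b)); lra.
  rewrite addrAC DgM ?normr0 //; rewrite coord_add.
  have := ler_normD (coord b z) (coord b (x *: axis R c)); have := cx b.
  by move: sL; rewrite /L; have := ler_norm M; lra.
have dF : is_derive (0 : R) 1 (fun x : R => lineint D b g (z + x *: axis R c))
    (lineint D b ('D_(axis R c) g) z).
  rewrite -Ffun; apply: DeriveDef.
    exact: (@derivable_under_integral R _ _ mu f D mD 0 (-1) 1 I0 intf derf G G0 intG Gub).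
  rewrite -derive1E (@differentiation_under_integral R _ _ mu f D mD 0 (-1) 1 I0 intf derf G G0 intG Gub).
  by apply: eq_Rintegral => s _; rewrite dfE scale0r addr0.
(* The derivative at 0 along the line has the same difference quotient as the directional derivative
   at [z]. *)
have E : (fun h : R => h^-1 *: (((fun x : R => lineint D b g (z + x *: axis R c)) \o shift 0)
      (h *: 1) - lineint D b g (z + 0 *: axis R c))) =
    (fun h : R => h^-1 *: ((lineint D b g \o shift z) (h *: axis R c) - lineint D b g z)).
  by apply/funext => h /=; rewrite [h *: 1]mulr1 addr0 scale0r addr0 [z + _]addrC.
apply: DeriveDef.
  by have := @ex_derive _ _ _ _ _ _ _ dF; rewrite /derivable E.
by have := @derive_val _ _ _ _ _ _ _ dF; rewrite /derive E.
Qed.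

Lemma derive_lineint D b c g : measurable D -> Rsmooth g -> bounded_along b g ->
  'D_(axis R c) (lineint D b g) = lineint D b ('D_(axis R c) g).
Proof.
move=> mD sg bg; apply/funext => z.
exact: (@derive_val _ _ _ _ _ _ _ (lineint_derive z mD sg bg c)).
Qed.

(** Line integrals over a fixed [D] form a stable class, since partial derivatives pass under the
    integral sign. *)
Lemma Rsmooth_lineint D b g : measurable D -> Rsmooth g -> bounded_along b g ->
  Rsmooth (lineint D b g).
Proof.
move=> mD sg bg; apply: (@Rsmooth_coind R
  (fun h => exists g, [/\ Rsmooth g, bounded_along b g & h = lineint D b g])); last by exists g.
move=> _ [f [sf bf ->]]; split=> [|c].
  by apply: lineint_continuous => //; exact: Rsmooth_continuous.
split=> [z|]; first exact: (@ex_derive _ _ _ _ _ _ _ (lineint_derive z mD sf bf c)).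
exists ('D_(axis R c) f); split; [exact: Rsmooth_derive|exact: bounded_along_derive|].
exact: derive_lineint.
Qed.

Let on_line b g z : Rsmooth g -> bounded_along b g ->
  exists L, [/\ forall s : R, is_derive s 1 (fun t : R => g (z + t *: axis R b))
    ('D_(axis R b) g (z + s *: axis R b)),
    continuous (fun t : R => 'D_(axis R b) g (z + t *: axis R b)),
    forall s, L < `|s| -> g (z + s *: axis R b) = 0 &
    forall s, L < `|s| -> 'D_(axis R b) g (z + s *: axis R b) = 0].
Proof.
move=> sg bg; have [M gM] := bounded_support_on_line bg.
have [N DgN] := bounded_support_on_line (bounded_along_derive b bg).
exists (Num.max M N + `|coord b z|); split=> [s||s|s].
- exact: is_derive_line (Rsmooth_derivable sg).
- exact: (continuous_on_line (Rsmooth_continuous (Rsmooth_derive b sg))).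
- move=> Ls; apply: gM; apply: le_lt_trans Ls.
  by rewrite lerD2r le_max lexx.
- move=> Ls; apply: DgN; apply: le_lt_trans Ls.
  by rewrite lerD2r le_max lexx orbT.
Qed.

Lemma lineint_derive_itvNy b g : Rsmooth g -> bounded_along b g ->
  lineint `]-oo, 0] b ('D_(axis R b) g) = g.
Proof.
move=> sg bg; apply/funext => z; have [L [h1 h2 h3 h4]] := on_line z sg bg.
by rewrite /lineint (Rintegral_derive_itvNy h1 h2 h3 h4) scale0r addr0.
Qed.

Lemma lineint_deriveT b g : Rsmooth g -> bounded_along b g ->
  lineint setT b ('D_(axis R b) g) = cst 0.
Proof.
move=> sg bg; apply/funext => z; have [L [h1 h2 h3 h4]] := on_line z sg bg.
by rewrite /lineint (Rintegral_deriveT h1 h2 h3 h4).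
Qed.

(** No change of variables: the derivative of the marginal along [b] is the marginal of the
    derivative, which is 0 by the fundamental theorem of calculus. *)
Lemma lineintT_invariant b g z s : Rsmooth g -> bounded_along b g ->
  lineint setT b g (z + s *: axis R b) = lineint setT b g z.
Proof.
move=> sg bg; rewrite -[in RHS](addr0 z) -[in RHS](scale0r (axis R b)).
apply: (@is_derive_0_is_cst R (fun t : R => lineint setT b g (z + t *: axis R b))) => t.
have <- : 'D_(axis R b) (lineint setT b g) (z + t *: axis R b) = 0.
  have := derive_lineint b measurableT sg bg; rewrite lineint_deriveT // => h.
  exact: (congr1 (fun f => f (z + t *: axis R b)) h).
exact: is_derive_line (Rsmooth_derivable (Rsmooth_lineint _ sg bg)).
Qed.
End LineIntegral.

(** * Real test functions, their marginals, and splitting off derivatives *)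

Section TestFunctions.
Local Open Scope classical_set_scope.
Variable R : realType.
Local Notation plane := (R * R)%type.
Local Notation mu := (@lebesgue_measure R).
Implicit Types (b c : bool) (g f : plane -> R) (z v w : plane).

(** Bounded support along both axes amounts to compact support; see [Csmooth_cP]. *)
Definition test g := Rsmooth g /\ forall b, bounded_along b g.

Lemma test_derive b g : test g -> test ('D_(axis R b) g).
Proof.
move=> [sg bg]; split=> [|c]; first exact: Rsmooth_derive.
exact: bounded_along_derive.
Qed.
Lemma testD f g : test f -> test g -> test (f + g).
Proof.
move=> [sf bf] [sg bg]; split=> [|c]; first exact: RsmoothD.
exact: bounded_alongD.
Qed.
Lemma testM f g : test f -> test g -> test (f * g).
Proof.
move=> [sf bf] [sg bg]; split=> [|c]; first exact: RsmoothM.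
exact: bounded_alongMl.
Qed.
Lemma testZ (k : R) g : test g -> test (fun z => k * g z).
Proof.
move=> [sg bg]; split=> [|c]; first exact: RsmoothZ.
exact: bounded_alongZ.
Qed.
Lemma test_shift w g : test g -> test (fun z => g (w + z)).
Proof.
move=> [sg bg]; split=> [|c]; first exact: Rsmooth_shift.
exact: bounded_along_shift.
Qed.

Definition marginal b g := lineint setT b g.

Lemma marginal_bounded b g : test g -> bounded_along (~~ b) (marginal b g).
Proof. by move=> [_ bg]; apply: bounded_along_lineint => //; case: b. Qed.
Lemma Rsmooth_marginal b g : Rsmooth g -> bounded_along b g -> Rsmooth (marginal b g).
Proof. by move=> sg bg; exact: Rsmooth_lineint. Qed.
Lemma marginal_derive b c g : Rsmooth g -> bounded_along b g ->
  marginal b ('D_(axis R c) g) = 'D_(axis R c) (marginal b g).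
Proof. by move=> sg bg; rewrite /marginal derive_lineint. Qed.

Lemma marginal_swap_invariant b g z s : (forall z s, g (z + s *: axis R (~~ b)) = g z) ->
  marginal b g (z + s *: axis R (~~ b)) = marginal b g z.
Proof.
by move=> gi; apply: eq_Rintegral => t _; rewrite addrAC gi.
Qed.

(* A primitive in the direction b of [f - h * marginal b f], whose integrals along the lines
   of direction b vanish. *)
Lemma marginal_decomposition b h f :
  Rsmooth h -> bounded_along b h -> marginal b h = cst 1 -> test f ->
  exists2 G, test G & f = 'D_(axis R b) G + h * marginal b f.
Proof.
move=> sh bh h1 tf; have [sf bf] := tf; have cf := Rsmooth_continuous sf.
have sMf := Rsmooth_marginal sf (bf b).
have ch := Rsmooth_continuous sh.
pose u := f - h * marginal b f.
have su : Rsmooth u by apply: RsmoothB => //; exact: RsmoothM.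
have bu c : bounded_along c u.
  apply: bounded_alongB => //; case: (c =P b) => [->|/eqP cb]; first exact: bounded_alongMl.
  by apply: bounded_alongMr; apply: bounded_along_lineint; rewrite // eq_sym.
have u0 z : marginal b u z = 0.
  have chM : continuous (fun z => -1 * (h * marginal b f) z).
    by apply: Rsmooth_continuous; apply: RsmoothZ; exact: RsmoothM.
  have uE : u = f + (fun z => -1 * (h * marginal b f) z).
    by apply/funext => w; rewrite /u !fctE mulN1r.
  rewrite uE /marginal lineintD //; last by apply: bounded_alongZ; exact: bounded_alongMl.
  rewrite lineintZ //; [|exact/Rsmooth_continuous/RsmoothM|exact: bounded_alongMl].
  rewrite [h * _]mulrC lineintM // => [|w s]; last exact: lineintT_invariant.
  rewrite -/(marginal b h) h1 !fctE; rewrite /=.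
  by rewrite mulr1 mulN1r subrr.
exists (lineint `]-oo, 0] b u); last first.
  rewrite derive_lineint // lineint_derive_itvNy //.
  by apply/funext => z; rewrite /u !fctE subrK.
split=> [|c]; first exact: Rsmooth_lineint.
case: (c =P b) => [->|/eqP cb]; last by apply: bounded_along_lineint; rewrite // eq_sym.
have [M uM] := bu b; exists `|M| => z Mz.
(* Left of the support the integrand vanishes on the whole half-line. Right of it the missing half
   [s > 0] contributes nothing, so the primitive equals the full marginal, which is 0 by [u0]; this
   is why [h * marginal b f] had to be subtracted. *)
have {Mz}[zM|Mz] : coord b z < - `|M| \/ `|M| < coord b z.
- by move: Mz; case: (ler0P (coord b z)) => _; lra.
- rewrite /lineint (@eq_Rintegral _ _ _ _ _ (cst 0)); first by rewrite /Rintegral integral0.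
  move=> s; rewrite inE /= in_itv /= => s0; apply: uM; rewrite coord_add coord_axis eqxx.
  by rewrite ltr_normr; apply/orP; right; have := ler_norm M; lra.
- transitivity (marginal b u z); last exact: u0.
  rewrite /marginal /lineint Rintegral_mkcond; apply: eq_Rintegral => s _.
  rewrite patchE; case: ifPn => // /negP s0; rewrite uM //.
  have s_gt0 : 0 < s.
    by rewrite ltNge; apply/negP => s_le0; apply: s0; rewrite inE /= in_itv /=.
  rewrite coord_add coord_axis eqxx.
  by rewrite ltr_normr; apply/orP; left; have := ler_norm M; lra.
Qed.

(** The base point 0 is an arbitrary choice: by [marginal2E] the iterated marginal of a test
    function is constant. *)
Definition plane_integral g : R := marginal false (marginal true g) 0.

Lemma marginal2E b g z : test g ->
  marginal b (marginal (~~ b) g) z = marginal b (marginal (~~ b) g) 0.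
Proof.
move=> tg; have [sg bg] := tg.
have zE : z = 0 + coord b z *: axis R b + coord (~~ b) z *: axis R (~~ b).
  apply: plane_coordP => c; rewrite !coord_add !coord_axis.
  by case: b c => [] [] /=; rewrite /coord /= ?add0r ?addr0.
rewrite {1}zE marginal_swap_invariant => [|w s]; last exact: lineintT_invariant.
apply: lineintT_invariant; first exact: Rsmooth_marginal.
by have := marginal_bounded (~~ b) tg; rewrite negbK.
Qed.

(** Positivity at one point [z] passes from [g * g] to its inner marginal at [z], and from there to
    the outer one. *)
Lemma marginal_square_gt0 b g : test g -> (exists z, g z != 0) ->
  0 < marginal b (marginal (~~ b) (g * g)) 0.
Proof.
move=> tg [z gz]; have tgg := testM tg tg; have [sgg bgg] := tgg.
have ge0 w : 0 <= marginal (~~ b) (g * g) w.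
  by apply: Rintegral_ge0 => s _; rewrite fctE -expr2 sqr_ge0.
rewrite -(marginal2E b z tgg).
have pos c f : Rsmooth f -> bounded_along c f -> (forall w, 0 <= f w) -> 0 < f z ->
    0 < marginal c f z.
  move=> sf bf f0 fz; have [M fM] := bounded_support_on_line bf.
  apply: (@Rintegral_gt0 R (fun s => f (z + s *: axis R c)) (M + `|coord c z|) 0) => //.
  - exact: continuous_on_line (Rsmooth_continuous sf).
  - exact: fM.
  - by rewrite scale0r addr0.
apply: (pos b) => //.
- exact: Rsmooth_marginal.
- by have := marginal_bounded (~~ b) tgg; rewrite negbK.
apply: (pos (~~ b)) => // [w|]; first by rewrite fctE -expr2 sqr_ge0.
by rewrite fctE -expr2 lt_def sqr_ge0 andbT expf_neq0.
Qed.

(* The squares of the marginals of a nonzero test function serve as bump functions in one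
   variable, so no explicit bump function is needed. *)
Lemma test_decomposition u : test u -> (exists z, u z != 0) ->
  exists2 w, test w & forall f, test f -> exists G H, [/\ test G, test H &
    f = 'D_(axis R true) G + 'D_(axis R false) H + (fun z => plane_integral f * w z)].
Proof.
move=> tu u0; have tuu := testM tu tu; have [suu buu] := tuu.
pose N b := marginal b (marginal (~~ b) (u * u)) 0.
(* [h b] depends on coordinate [b] alone, because the other one has been integrated out, and is
   normalised to have integral 1 along [axis R b]. *)
pose h b z := (N b)^-1 * marginal (~~ b) (u * u) z.
have sm b : Rsmooth (marginal (~~ b) (u * u)) by exact: Rsmooth_marginal.
have bm b : bounded_along b (marginal (~~ b) (u * u)).
  by have := marginal_bounded (~~ b) tuu; rewrite negbK.
have sh b : Rsmooth (h b) by exact: RsmoothZ.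
have bh b : bounded_along b (h b) by exact: bounded_alongZ.
have h1 b : marginal b (h b) = cst 1.
  rewrite /marginal /h lineintZ //; last exact: Rsmooth_continuous.
  apply/funext => z; rewrite -/(marginal b (marginal (~~ b) (u * u))) marginal2E //.
  by rewrite mulVf // gt_eqF // marginal_square_gt0.
have hi b z s : h b (z + s *: axis R (~~ b)) = h b z.
  by rewrite /h /marginal lineintT_invariant.
have th f b : test f -> test (h b * marginal b f).
  move=> tf; have [sf bf] := tf; split=> [|c].
    by apply: RsmoothM => //; exact: Rsmooth_marginal.
  case: (c =P b) => [->|cb]; first exact: bounded_alongMl.
  apply: bounded_alongMr; rewrite (_ : c = ~~ b); first exact: marginal_bounded.
  by case: c b cb {sm bm sh bh h1 hi} => [] [].
exists (h false * h true) => [|f tf].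
  split=> [|[]]; [exact: RsmoothM|exact: bounded_alongMr|exact: bounded_alongMl].
(* Splitting in the first variable leaves [h true * marginal true f], again a test function.
   Splitting this in the second variable leaves the plane integral of [f] times
   [h false * h true]. *)
have [G tG fE] := marginal_decomposition (sh true) (bh true) (h1 true) tf.
have tf2 := th f true tf.
have [H tH f2E] := marginal_decomposition (sh false) (bh false) (h1 false) tf2.
exists G, H; split=> //; rewrite [LHS]fE [in LHS]f2E addrA; congr (_ + _).
have cM : continuous (marginal true f).
  exact: Rsmooth_continuous (Rsmooth_marginal tf.1 (tf.2 true)).
have E : marginal false (h true * marginal true f) =
    h true * marginal false (marginal true f).
  have bM : bounded_along false (marginal true f) := marginal_bounded true tf.
  by apply: lineintM => // w s; exact: (hi true).
apply/funext => z; rewrite E !fctE (marginal2E false) // -/(plane_integral f).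
by rewrite /=; ring.
Qed.

Lemma test_marginal f : test f ->
  Rsmooth (marginal true f) /\ bounded_along false (marginal true f).
Proof.
move=> tf; split; first exact: Rsmooth_marginal tf.1 (tf.2 true).
exact: (marginal_bounded true tf).
Qed.

Lemma plane_integralD f g : test f -> test g ->
  plane_integral (f + g) = plane_integral f + plane_integral g.
Proof.
move=> tf tg; have [sf bf] := tf; have [sg bg] := tg; rewrite /plane_integral.
have [/Rsmooth_continuous sMf bMf] := test_marginal tf.
have [/Rsmooth_continuous sMg bMg] := test_marginal tg.
have -> : marginal true (f + g) = marginal true f + marginal true g.
  by apply: lineintD => //; exact: Rsmooth_continuous.
by rewrite [marginal false _]lineintD.
Qed.

Lemma plane_integralZ (k : R) f : test f ->
  plane_integral (fun z => k * f z) = k * plane_integral f.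
Proof.
move=> tf; have [sf bf] := tf; rewrite /plane_integral.
have [/Rsmooth_continuous sMf bMf] := test_marginal tf.
have -> : marginal true (fun z => k * f z) = (fun z => k * marginal true f z).
  by apply: lineintZ => //; exact: Rsmooth_continuous.
by rewrite [marginal false _]lineintZ.
Qed.

Lemma marginal_shift b w g :
  marginal b (fun z => g (w + z)) = (fun z => marginal b g (w + z)).
Proof. by apply/funext => z; exact: lineint_shift. Qed.

Lemma plane_integral_shift w f : test f ->
  plane_integral (fun z => f (w + z)) = plane_integral f.
Proof.
move=> tf; have E := marginal2E false (w + 0) tf.
by rewrite /plane_integral !marginal_shift; exact: E.
Qed.

Lemma plane_integral_derive b f : test f -> plane_integral ('D_(axis R b) f) = 0.
Proof.
move=> tf; have [sf bf] := tf; rewrite /plane_integral.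
have M0 : marginal false (cst 0) 0 = 0 by rewrite /marginal /lineint /Rintegral integral0.
case: b; first by rewrite [marginal true _]lineint_deriveT.
have [sMf bMf] := test_marginal tf.
by rewrite marginal_derive // [marginal false _]lineint_deriveT.
Qed.
End TestFunctions.

(** * Lebesgue integral on the plane as an iterated line integral *)

Section PlaneIntegral.
Local Open Scope classical_set_scope.
Variable R : realType.
Local Notation plane := (R * R)%type.
Local Notation mu := (@lebesgue_measure R).
Implicit Types (b c : bool) (g f : plane -> R) (z v w : plane).

(** The sigma-algebra on the plane is the product one, so an open set is written as the countable
    union of the products of rational balls that it contains. *)
Lemma open_plane_measurable (U : set plane) : open U -> measurable U.
Proof.
move=> oU; pose B (k : rat * rat) : set R := ball (ratr k.1 : R) (ratr k.2).
pose I := [set k : (rat * rat) * (rat * rat) | B k.1 `*` B k.2 `<=` U].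
have -> : U = \bigcup_(k in I) (B k.1 `*` B k.2).
  apply/seteqP; split=> [[x y] Uxy|z [k Ik Bk]]; last exact: Ik.
  have [[P Q] /= [nP nQ] PQU] : nbhs (x, y) U by exact: open_nbhs_nbhs.
  have sub (t : R) (S : set R) : nbhs t S -> exists k, B k t /\ B k `<=` S.
    move=> nS; have tS : t \in (S° : set R) by rewrite inE.
    have [c [r [/set_mem tB BS]]] := open_subball_rat (@open_interior R S) tS.
    by exists (c, r); split=> //; exact: subset_trans BS (@interior_subset R S).
  have [k1 [xB1 B1P]] := sub x P nP; have [k2 [yB2 B2Q]] := sub y Q nQ.
  exists (k1, k2) => //= -[x' y'] [/= h1 h2]; apply: PQU; split=> /=.
    exact: B1P.
  exact: B2Q.
rewrite bigcup_mkcond; apply: countable_bigcupT_measurable => [|k]; first exact: countableP.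
by case: ifP => _ //; apply: measurableX; exact: measurable_ball.
Qed.

Lemma continuous_plane_measurable g : continuous g -> measurable_fun setT g.
Proof.
move=> cg; apply: (measurability _ (RGenOpens.measurableE R)).
move=> _ [_ [a [b ->] <-]]; rewrite setTI; apply: open_plane_measurable.
by apply: open_comp => [z _|]; [exact: cg|exact: interval_open].
Qed.

Lemma test_integrable g : test g -> (mu \x mu)%E.-integrable setT (EFin \o g).
Proof.
move=> [sg bg]; have cg := Rsmooth_continuous sg.
have [M gM] := bg true; have [N gN] := bg false.
pose L := `|M| + `|N|.
pose K : set plane := `[- L, L] `*` `[- L, L].
have -> : EFin \o g = (EFin \o g) \_ K.
  apply/funext => z; rewrite patchE; case: ifPn => // /negP h /=.
  congr EFin; apply: contrapT => gz; apply: h; rewrite inE; split=> /=.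
    rewrite in_itv /= -ler_norml leNgt; apply/negP => zL; apply: gz; apply: gM.
    by apply: le_lt_trans zL; rewrite /L; have := ler_norm M; have := normr_ge0 N; lra.
  rewrite in_itv /= -ler_norml leNgt; apply/negP => zL; apply: gz; apply: gN.
  by apply: le_lt_trans zL; rewrite /L; have := ler_norm N; have := normr_ge0 M; lra.
have mK : measurable K by apply: measurableX.
apply/integrable_restrict => //; rewrite setTI; apply: measurable_bounded_integrable => //.
- have fK : (mu (`[(- L)%R, L] : set R) < +oo)%E.
    by apply: compact_finite_measure; exact: segment_compact.
  have mI : measurable (`[- L, L] : set R) by [].
  have E := product_measure1E mu mu mI mI.
  rewrite [X in (X < _)%E]E; apply: lte_mul_pinfty => //.
  by rewrite ge0_fin_numE.
- exact: measurable_funS (continuous_plane_measurable cg).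
- have [C C0 hC] := continuous_bounded_box L cg.
  exists C; split; first exact: num_real.
  move=> x Cx z [z1 z2]; apply: le_trans (ltW Cx); apply: hC => b.
  by move: z1 z2; rewrite /= !in_itv /= -!ler_norml; case: b.
Qed.

Lemma Rintegral_plane g : test g -> \int[(mu \x mu)%E]_z g z = plane_integral g.
Proof.
move=> tg; have [sg bg] := tg; have ig := test_integrable tg.
(* This form of Fubini integrates the first coordinate inside, matching the order of the marginals
   in [plane_integral]. *)
rewrite {1}/Rintegral -(integral21_prod_meas1 ig) /plane_integral /marginal /lineint.
congr fine; apply: eq_integral => y _; rewrite /fubini_G.
have ci := integrable_on_line (0 + y *: axis R false) measurableT
  (Rsmooth_continuous sg) (bg true).
rewrite /Rintegral fineK; last exact: integrable_fin_num ci.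
have lineE (s t : R) : (s, t) = 0 + t *: axis R false + s *: axis R true.
  apply: plane_coordP => c; rewrite !coord_add !coord_axis.
  by case: c; rewrite /coord /= ?add0r ?addr0.
by apply: eq_integral => x _ /=; rewrite (lineE x y).
Qed.

End PlaneIntegral.

(** * Complex test functions and the characterisation of their integral *)

Section ComplexTestFunctions.
Local Open Scope classical_set_scope.
Variable R : realType.
Local Notation C := R[i].
Local Notation plane := (R * R)%type.
Implicit Types (b : bool) (f g : plane -> C) (u : plane -> R) (z w : plane).

Definition re_part f : plane -> R := fun z => complex.Re (f z).
Definition im_part f : plane -> R := fun z => complex.Im (f z).
Definition of_real u : plane -> C := fun z => Complex (u z) 0.

Lemma complexE (x : C) : x = Complex (complex.Re x) (complex.Im x).
Proof. by case: x. Qed.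

Lemma coord_le_norm b z : `|coord b z| <= `|z|.
Proof.
by case: b z => -[x y]; rewrite /coord /= [leRHS]/Num.norm /= le_max lexx ?orbT.
Qed.

Lemma Csmooth_cP f : Csmooth_c f <-> test (re_part f) /\ test (im_part f).
Proof.
split=> [[sf /compact_bounded[M [_ hM]]]|[[sR bR] [sI bI]]].
  have f0 b z : M + 1 < `|coord b z| -> f z = 0.
    move=> Mz; apply: contrapT => /eqP fz.
    have /hM : M < M + 1 by rewrite ltrDl.
    have zS : closure [set z | f z != 0] z by exact: subset_closure.
    move/(_ z zS) => /=; rewrite leNgt => /negP; apply.
    exact: lt_le_trans Mz (coord_le_norm b z).
  by split; split=> [k|b]; [exact: (sf k).1|exists (M + 1) => z /f0; rewrite /re_part => ->
    |exact: (sf k).2|exists (M + 1) => z /f0; rewrite /im_part => ->].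
split; first by move=> k; split; [exact: sR|exact: sI].
have [M1 h1] := bR true; have [M2 h2] := bR false.
have [M3 h3] := bI true; have [M4 h4] := bI false.
pose L := `|M1| + `|M2| + `|M3| + `|M4|.
have LM : [/\ M1 <= L, M2 <= L, M3 <= L & M4 <= L].
  have := normr_ge0 M1; have := normr_ge0 M2; have := normr_ge0 M3; have := normr_ge0 M4.
  have := ler_norm M1; have := ler_norm M2; have := ler_norm M3; have := ler_norm M4.
  by rewrite /L; split; lra.
have [L1 L2 L3 L4] := LM.
have cK : compact (`[- L, L] `*` `[- L, L] : set plane).
  by apply: compact_setX; exact: segment_compact.
apply: (subclosed_compact _ cK); first exact: closed_closure.
have /closure_id -> : closed (`[- L, L] `*` `[- L, L] : set plane).
  by apply: compact_closed => //; exact: norm_hausdorff.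
apply: closure_subset => z /= /eqP fz.
have bnd b : `|coord b z| <= L.
  rewrite leNgt; apply/negP => zL; apply: fz; rewrite (complexE (f z)).
  rewrite -/(re_part f z) -/(im_part f z).
  case: b zL => zL.
    by rewrite h1 ?h3 // (le_lt_trans _ zL).
  by rewrite h2 ?h4 // (le_lt_trans _ zL).
by rewrite !in_itv /= -!ler_norml; split; [exact: (bnd true)|exact: (bnd false)].
Qed.

Lemma re_part_lin (c : C) f g : re_part (fun z => c * f z + g z) =
  (fun z => complex.Re c * re_part f z) + (fun z => - complex.Im c * im_part f z) + re_part g.
Proof.
apply/funext => z; rewrite !fctE /re_part /im_part.
by case: c (f z) (g z) => [? ?] [? ?] [? ?] /=; ring.
Qed.
Lemma im_part_lin (c : C) f g : im_part (fun z => c * f z + g z) =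
  (fun z => complex.Re c * im_part f z) + (fun z => complex.Im c * re_part f z) + im_part g.
Proof.
apply/funext => z; rewrite !fctE /re_part /im_part.
by case: c (f z) (g z) => [? ?] [? ?] [? ?] /=; ring.
Qed.

Lemma Csmooth_c_lin (c : C) f g : Csmooth_c f -> Csmooth_c g ->
  Csmooth_c (fun z => c * f z + g z).
Proof.
move=> /Csmooth_cP[fR fI] /Csmooth_cP[gR gI]; apply/Csmooth_cP.
rewrite re_part_lin im_part_lin.
by split; apply: testD => //; apply: testD; exact: testZ.
Qed.

Lemma Csmooth_c_derive b f : Csmooth_c f -> Csmooth_c (Cderive (axis R b) f).
Proof.
by move=> /Csmooth_cP[fR fI]; apply/Csmooth_cP; split; exact: test_derive.
Qed.

Lemma Csmooth_c_shift w f : Csmooth_c f -> Csmooth_c (fun z => f (w + z)).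
Proof.
move=> /Csmooth_cP[fR fI]; apply/Csmooth_cP.
by split; [exact: (test_shift w fR)|exact: (test_shift w fI)].
Qed.

Lemma ICE f : Csmooth_c f ->
  IC f = Complex (plane_integral (re_part f)) (plane_integral (im_part f)).
Proof.
by move=> /Csmooth_cP[fR fI]; rewrite -!Rintegral_plane.
Qed.

Lemma IC_lin (c : C) f g : Csmooth_c f -> Csmooth_c g ->
  IC (fun z => c * f z + g z) = c * IC f + IC g.
Proof.
move=> cf cg; rewrite !ICE //; last exact: Csmooth_c_lin.
move: cf cg => /Csmooth_cP[fR fI] /Csmooth_cP[gR gI].
have tz k u : test u -> test (fun z => k * u z) by exact: testZ.
rewrite re_part_lin im_part_lin !plane_integralD ?plane_integralZ //; try exact: tz;
  try (by apply: testD; exact: tz).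
by case: c => a b; congr Complex => /=; ring.
Qed.

Lemma IC_shift w f : Csmooth_c f -> IC (fun z => f (w + z)) = IC f.
Proof.
move=> cf; have [fR fI] := (Csmooth_cP f).1 cf.
rewrite (ICE (Csmooth_c_shift w cf)) (ICE cf).
have hR := plane_integral_shift w fR; have hI := plane_integral_shift w fI.
exact: congr2 hR hI.
Qed.

Lemma IC_derive b f : Csmooth_c f -> IC (Cderive (axis R b) f) = 0.
Proof.
move=> cf; rewrite ICE; last exact: Csmooth_c_derive.
by move: cf => /Csmooth_cP[fR fI]; congr Complex; exact: plane_integral_derive.
Qed.

Lemma Csmooth_c_of_real u : test u -> Csmooth_c (of_real u).
Proof.
move=> tu; apply/Csmooth_cP; split=> //.
rewrite (_ : im_part _ = fun z => 0 * u z); first exact: testZ.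
by apply/funext => z; rewrite mul0r.
Qed.

Lemma Cderive_of_real b u : Cderive (axis R b) (of_real u) = of_real ('D_(axis R b) u).
Proof.
apply/funext => z; rewrite /Cderive /of_real; congr Complex.
exact: derive_cst.
Qed.

Lemma IC_unique (psi : (plane -> C) -> C) :
  (forall (c : C) f g, Csmooth_c f -> Csmooth_c g ->
    psi (fun z => c * f z + g z) = c * psi f + psi g) ->
  (forall b f, Csmooth_c f -> psi (Cderive (axis R b) f) = 0) ->
  exists k, forall f, Csmooth_c f -> psi f = k * IC f.
Proof.
move=> psi_lin psi_derive.
have t0 : test (cst 0 : plane -> R).
  split=> [|b]; first exact: Rsmooth_cst.
  by exists 0.
have psi0 : psi (of_real (cst 0)) = 0.
  have c0 := Csmooth_c_of_real t0; have := psi_lin 1 _ _ c0 c0.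
  rewrite (_ : (fun z => _) = of_real (cst 0)).
    by rewrite mul1r => /esym/(canRL (addrK _)); rewrite subrr.
  by apply/funext => z; rewrite mul1r; congr Complex; rewrite addr0.
(* Complex linearity of [psi] reduces the claim to real-valued test functions. *)
have split_f f : f = (fun z => Complex 0 1 * of_real (im_part f) z + of_real (re_part f) z).
  apply/funext => z; rewrite /of_real /re_part /im_part.
  by case: (f z) => x y; congr Complex => /=; ring.
(* A case distinction replaces the construction of a nonzero test function: if there were none,
   every test function would be [cst 0] and [psi] would vanish on all of them. *)
have [[u [tu u0]]|nou] := pselect (exists u, test u /\ exists z, u z != 0).
  have [w tw dec] := test_decomposition tu u0.
  have key (f : plane -> R) : test f -> psi (of_real f) = psi (of_real w) * Complex (plane_integral f) 0.
    move=> tf; have [G [H [tG tH fE]]] := dec f tf.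
    have cG := Csmooth_c_of_real tG; have cH := Csmooth_c_of_real tH.
    have cw := Csmooth_c_of_real tw.
    have cDG := Csmooth_c_derive true cG; have cDH := Csmooth_c_derive false cH.
    rewrite (_ : of_real f = (fun z => Complex (plane_integral f) 0 * of_real w z +
      (1 * Cderive (axis R true) (of_real G) z + Cderive (axis R false) (of_real H) z))).
      rewrite psi_lin //; last exact: Csmooth_c_lin.
      by rewrite psi_lin // !psi_derive // mulr0 !addr0 mulrC.
    apply/funext => z; rewrite !Cderive_of_real mul1r {1}fE /of_real; congr Complex => /=.
      by rewrite !fctE; ring.
    by ring.
  exists (psi (of_real w)) => f cf; have [fR fI] := (Csmooth_cP f).1 cf.
  rewrite ICE // {1}(split_f f) psi_lin; [|exact: Csmooth_c_of_real|exact: Csmooth_c_of_real].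
  rewrite (key _ fI) (key _ fR) mulrCA -mulrDr; congr (_ * _); congr Complex => /=; ring.
have test0 u : test u -> u = cst 0.
  move=> tu; apply/funext => z; apply: contrapT => /eqP uz.
  by apply: nou; exists u; split=> //; exists z.
exists 0 => f cf; have [fR fI] := (Csmooth_cP f).1 cf.
rewrite mul0r (split_f f) (test0 _ fR) (test0 _ fI) psi_lin; try exact: Csmooth_c_of_real.
by rewrite psi0 mulr0 addr0.
Qed.
End ComplexTestFunctions.

(** * The q-binomial formula with invertible coefficients *)

Section QBinomial.
Variables (K : fieldType) (D : algType K) (X Y : D) (w : K).
Hypothesis YX : Y * X = w *: (X * Y).

(** Up to sign the q-Pochhammer symbol (w; w)_n; the signs cancel in the Gaussian binomial [qbin].
    Written as a quotient, the latter is visibly nonzero while no power of [w] up to [n] is 1. *)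
Definition qpoch n : K := \prod_(j < n) (w ^+ j.+1 - 1).
Definition qbin n k : K := qpoch n / (qpoch k * qpoch (n - k)).

Lemma qpochS n : qpoch n.+1 = qpoch n * (w ^+ n.+1 - 1).
Proof. exact: big_ord_recr. Qed.

Lemma qpoch_neq0 n : (forall j, (0 < j <= n)%N -> w ^+ j != 1) -> qpoch n != 0.
Proof.
move=> hw; apply/prodf_neq0 => j _; rewrite subr_eq0; apply: hw.
by rewrite /= ltn_ord.
Qed.

Lemma qbin_neq0 n k : (forall j, (0 < j <= n)%N -> w ^+ j != 1) -> (k <= n)%N -> qbin n k != 0.
Proof.
move=> hw kn; have hp m : (m <= n)%N -> qpoch m != 0.
  move=> mn; apply: qpoch_neq0 => j /andP[j0 jm]; apply: hw.
  by rewrite j0 (leq_trans jm).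
by rewrite mulf_neq0 ?invr_neq0 ?mulf_neq0 ?hp ?leq_subr.
Qed.

Lemma qbin0 n : (forall j, (0 < j <= n)%N -> w ^+ j != 1) -> qbin n 0 = 1.
Proof. by move=> hw; rewrite /qbin /qpoch big_ord0 mul1r subn0 divff // qpoch_neq0. Qed.
Lemma qbinn n : (forall j, (0 < j <= n)%N -> w ^+ j != 1) -> qbin n n = 1.
Proof. by move=> hw; rewrite /qbin subnn {3}/qpoch big_ord0 mulr1 divff // qpoch_neq0. Qed.

(* The coefficients are normalised by [qpoch]: with [E k = X ^+ k / qpoch k] and
   [F k = Y ^+ k / qpoch k], [(X + Y) ^+ n / qpoch n] is the sum of [E k * F (n - k)]. *)
Lemma qbinomial n : (forall j, (0 < j <= n)%N -> w ^+ j != 1) ->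
  (X + Y) ^+ n = \sum_(k < n.+1) qbin n k *: (X ^+ k * Y ^+ (n - k)).
Proof.
elim: n => [|n IH] hw.
  by rewrite big_ord1 qbin0 // scale1r !expr0 mulr1.
have hw' j : (0 < j <= n)%N -> w ^+ j != 1.
  by case/andP=> j0 jn; apply: hw; rewrite j0 leqW.
have hp m : (m <= n.+1)%N -> qpoch m != 0.
  move=> mn; apply: qpoch_neq0 => j /andP[j0 jm]; apply: hw.
  by rewrite j0 (leq_trans jm).
have hw1 m : (m < n.+1)%N -> w ^+ m.+1 - 1 != 0 by move=> mn; rewrite subr_eq0 hw.
(* [XS] and [YS] are put over the same denominators and the same range. The boundary term added for
   this, [k = 0] in [XS] and [k = n.+1] in [YS], has zero numerator. *)
have XS : X * (X + Y) ^+ n = \sum_(k < n.+2)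
    (qpoch n * (w ^+ k - 1) / (qpoch k * qpoch (n.+1 - k))) *: (X ^+ k * Y ^+ (n.+1 - k)).
  rewrite IH // mulr_sumr [RHS]big_ord_recl /= expr0 subrr mulr0 mul0r scale0r add0r.
  apply: eq_bigr => k _; rewrite -scalerAr mulrA -exprS /bump /= add1n subSS.
  congr (_ *: _); rewrite /qbin qpochS.
  have hk : (k < n.+1)%N := ltn_ord k.
  have h1 := hw1 k hk; have h2 := hp k (ltnW hk).
  have h3 := hp (n - k)%N (leq_trans (leq_subr _ _) (leqnSn n)).
  by field; rewrite h1 h2 h3.
have YS : Y * (X + Y) ^+ n = \sum_(k < n.+2)
    (qpoch n * (w ^+ n.+1 - w ^+ k) / (qpoch k * qpoch (n.+1 - k))) *:
    (X ^+ k * Y ^+ (n.+1 - k)).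
  rewrite IH // mulr_sumr [RHS]big_ord_recr /= subrr mulr0 mul0r scale0r addr0.
  apply: eq_bigr => k _; have hk : (k < n.+1)%N := ltn_ord k.
  have := qcommX 1 k YX; rewrite !expr1 mul1n => h.
  rewrite -scalerAr mulrA h -scalerAl -[X ^+ k * Y * _]mulrA -exprS scalerA subSn //.
  congr (_ *: _); rewrite /qbin qpochS.
  have -> : w ^+ n.+1 = w ^+ k * w ^+ (n - k).+1 by rewrite -exprD addnS subnKC.
  have h1 : w ^+ (n - k).+1 - 1 != 0 by apply: hw1; rewrite ltnS leq_subr.
  have h2 := hp k (ltnW hk).
  have h3 := hp (n - k)%N (leq_trans (leq_subr _ _) (leqnSn n)).
  by field; rewrite h1 h2 h3.
(* The numerators add up to [w ^+ n.+1 - 1], the quotient of [qpoch n.+1] by [qpoch n]. *)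
rewrite exprS mulrDl XS YS -big_split; apply: eq_bigr => k _ /=.
rewrite -scalerDl /qbin qpochS -mulrDl; congr (_ / _ *: _); ring.
Qed.
End QBinomial.

(** * Products and powers of pure tensors *)

Section PureTensors.
Variables (K : fieldType) (p : nat) (q : K) (hq : p.-primitive_root q).
Local Notation A := (AE hq).
Local Notation A2 := (AE2 hq).
Local Notation pure := (AEt_pure hq).

Let p_gt0 : (0 < p)%N. Proof. exact: prim_order_gt0 hq. Qed.

Lemma pureM (B : algType K) s t (b b' : B) :
  (pure s b : AEt hq B) * pure t b' = twist q s t *: (pure (addexp s t) (b * b') : AEt hq B).
Proof. exact: AEt_mulE. Qed.

Lemma tens_pure s (b : A) : tens (pure s 1 : A) b = pure s b.
Proof.
by apply: AEtP => l; rewrite !ffunE; case: ifP => _; rewrite ?scale1r ?scale0r.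
Qed.

(** The hypothesis says that [s] is a power of delta alone or of a single eta alone, so no
    reordering factor arises. *)
Lemma pure_expX (b : A) s n : (s.1.1 = 0 /\ s.1.2 = 0 \/ s.2 = 0 /\ s.1.1 * s.1.2 = 0)%N ->
  (pure s b : A2) ^+ n = pure (n * s.1.1, n * s.1.2, n * s.2)%N (b ^+ n).
Proof.
move=> hs; elim: n => [|n IH]; first by rewrite !expr0 !mul0n.
rewrite exprSr IH pureM exprSr /twist /addexp /=.
have -> : (n * s.1.2 * s.1.1 = 0)%N.
  by case: hs => [[-> _]|[_ h]]; rewrite ?muln0 // -mulnA [(s.1.2 * _)%N]mulnC h muln0.
have -> : (n * s.2 * (s.1.1 + s.1.2) = 0)%N.
  by case: hs => [[-> ->]|[-> _]]; rewrite ?muln0.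
by rewrite muln0 expr0 divr1 scale1r !mulSn ![(_ + n * _)%N]addnC.
Qed.

End PureTensors.

Lemma sum_mul2 (D : pzRingType) (n m : nat) (f : 'I_n -> D) (g : 'I_m -> D) :
  (\sum_k f k) * (\sum_j g j) = \sum_k \sum_j f k * g j.
Proof. by rewrite mulr_suml; apply: eq_bigr => k _; rewrite mulr_sumr. Qed.

Lemma sum_mul3 (D : pzRingType) (n m : nat) (f : 'I_n -> D) (g : 'I_m -> D) (x : D) :
  (\sum_k f k) * (\sum_j g j) * x = \sum_k \sum_j f k * g j * x.
Proof.
by rewrite sum_mul2 mulr_suml; apply: eq_bigr => k _; rewrite mulr_suml.
Qed.

(** * Explicit coordinates of the coproduct of a monomial *)

Section CoproductCoordinates.
Variables (K : fieldType) (p : nat) (q : K) (hq : p.-primitive_root q).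
Hypothesis podd : odd p.
Local Notation A := (AE hq).
Local Notation A2 := (AE2 hq).
Local Notation pure := (AEt_pure hq).

Let p_gt0 : (0 < p)%N. Proof. exact: prim_order_gt0 hq. Qed.

(** The constants [w] in [Y * X = w *: (X * Y)] for the two summands of the coproducts of [etaP] and
    [etaM]. The form of [wM] reflects that [deltaV] is [delta ^+ p.-1]; its value is [q ^+ 2]. *)
Definition wP : K := (q ^+ 2)^-1.
Definition wM : K := (q ^+ (2 * p.-1))^-1.

Lemma prim_root_neq0 : q != 0.
Proof.
apply/eqP=> q0; have /eqP := prim_expr_order hq.
by rewrite q0 expr0n eqn0Ngt p_gt0 eq_sym oner_eq0.
Qed.

(** Oddness of p enters here, as coprimality of 2 and p. *)
Lemma q2_expr_neq1 j : (0 < j < p)%N -> q ^+ (2 * j) != 1.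
Proof.
case/andP=> j0 jp; rewrite -(prim_order_dvd hq) Gauss_dvdr; last by rewrite coprimen2.
by rewrite gtnNdvd.
Qed.

Lemma wP_expr_neq1 n : (n < p)%N -> forall j, (0 < j <= n)%N -> wP ^+ j != 1.
Proof.
move=> np j /andP[j0 jn]; rewrite /wP exprVn -exprM invr_eq1.
by rewrite q2_expr_neq1 // j0 (leq_ltn_trans jn).
Qed.

Lemma wM_expr_neq1 n : (n < p)%N -> forall j, (0 < j <= n)%N -> wM ^+ j != 1.
Proof.
move=> np j /andP[j0 jn]; rewrite /wM exprVn -exprM invr_eq1.
have jp : (0 < j < p)%N by rewrite j0 (leq_ltn_trans jn).
apply: contra (q2_expr_neq1 jp) => /eqP h.
have : q ^+ (2 * p.-1 * j) * q ^+ (2 * j) = 1.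
  rewrite -exprD -mulnA -mulnDr -[X in (_ + X)%N]mul1n -mulnDl addn1 prednK //.
  by rewrite mulnCA exprM (prim_expr_order hq) expr1n.
by rewrite h mul1r => ->.
Qed.

Definition mon n m k : A := pure (n, m, k) 1.

Lemma AEmonE' (i : AEidx p) : AEmon hq i = mon i.1.1 i.1.2 i.2.
Proof. exact: monE. Qed.

Lemma Delta_etaPE : Delta_etaP hq = (pure (1, 0, 0)%N 1 : A2) + pure (0, 0, 1)%N (etaP hq).
Proof. by rewrite /Delta_etaP !tens_pure. Qed.
Lemma Delta_etaME : Delta_etaM hq = (pure (0, 1, 0)%N 1 : A2) + pure (0, 0, p.-1)%N (etaM hq).
Proof. by rewrite /Delta_etaM /deltaV delta_exp !tens_pure. Qed.
Lemma Delta_deltaE : Delta_delta hq = pure (0, 0, 1)%N (delta hq).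
Proof. exact: tens_pure. Qed.

Lemma Delta_etaP_exp n : (n < p)%N -> Delta_etaP hq ^+ n =
  \sum_(k < n.+1) qbin wP n k *: (pure (k : nat, 0, (n - k))%N (etaP hq ^+ (n - k)) : A2).
Proof.
move=> np; rewrite Delta_etaPE (@qbinomial K A2 _ _ wP).
- apply: eq_bigr => k _; congr (_ *: _); rewrite !pure_expX /=; last 2 first.
  + by left.
  + by right.
  rewrite !muln0 !muln1 expr1n pureM /twist /addexp /= !muln0 !expr0 divr1 scale1r.
  by rewrite mul1r !addn0 add0n.
- rewrite !pureM !scalerA /twist /addexp /= !muln0 !expr0 divr1 !mulr1 !mul1r.
  by rewrite ?muln1 ?addn0 ?add0n.
- exact: wP_expr_neq1.
Qed.

Lemma Delta_etaM_exp n : (n < p)%N -> Delta_etaM hq ^+ n =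
  \sum_(k < n.+1) qbin wM n k *:
    (pure (0, k : nat, ((n - k) * p.-1))%N (etaM hq ^+ (n - k)) : A2).
Proof.
move=> np; rewrite Delta_etaME (@qbinomial K A2 _ _ wM).
- apply: eq_bigr => k _; congr (_ *: _); rewrite !pure_expX /=; last 2 first.
  + by left.
  + by right.
  rewrite !muln0 !muln1 expr1n pureM /twist /addexp /= !muln0 !expr0 divr1 scale1r.
  by rewrite mul1r !addn0 add0n.
- rewrite !pureM !scalerA /twist /addexp /= !muln0 ?mul0n ?muln0 !expr0 divr1 !mulr1 !mul1r.
  by rewrite ?muln1 ?addn0 ?add0n.
- exact: wM_expr_neq1.
Qed.

Lemma Delta_delta_exp n : Delta_delta hq ^+ n = (pure (0, 0, n)%N (delta hq ^+ n) : A2).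
Proof. by rewrite Delta_deltaE pure_expX /=; [rewrite !muln0 muln1|left]. Qed.

(** The power of [q] comes from moving [delta ^+ (n - k)] past [etaM ^+ j] in the first leg; the
    second leg is already in normal order. *)
Definition dcoef (n m k j : nat) : K :=
  qbin wP n k * qbin wM m j / q ^+ (2 * ((n - k) * j)).

Lemma DeltaA_mon_expand (a : AEidx p) : DeltaA (AEmon hq a) =
  \sum_(k < a.1.1.+1) \sum_(j < a.1.2.+1) dcoef a.1.1 a.1.2 k j *:
    (pure (k : nat, j : nat, (a.1.1 - k + (a.1.2 - j) * p.-1 + a.2))%N
      (mon (a.1.1 - k) (a.1.2 - j) a.2) : A2).
Proof.
rewrite DeltaA_mon Delta_etaP_exp ?ltn_ord // Delta_etaM_exp ?ltn_ord // Delta_delta_exp.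
rewrite (sum_mul3 (D := A2)); apply: eq_bigr => k _; apply: eq_bigr => j _.
rewrite -scalerAl -scalerAr -!scalerAl scalerA pureM -scalerAl pureM !scalerA.
rewrite /mon -(monE hq) /twist /addexp /= ?muln0 ?mul0n ?expr0 ?add0n ?addn0 ?divr1 ?mulr1 ?mul1r.
by rewrite /dcoef ?muln0 ?mulrA.
Qed.

Lemma dcoef_neq0 n m k j : (n < p)%N -> (m < p)%N -> (k <= n)%N -> (j <= m)%N ->
  dcoef n m k j != 0.
Proof.
move=> np mp kn jm; rewrite /dcoef; apply: mulf_neq0; last first.
  by rewrite invr_neq0 // expf_neq0 // prim_root_neq0.
apply: mulf_neq0; apply: qbin_neq0 => //; first exact: wP_expr_neq1.
exact: wM_expr_neq1.
Qed.

Lemma dcoef00 n m : (n < p)%N -> (m < p)%N -> dcoef n m 0 0 = 1.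
Proof.
move=> np mp; rewrite /dcoef !qbin0; [|exact: wM_expr_neq1|exact: wP_expr_neq1].
by rewrite !muln0 expr0 divr1 mulr1.
Qed.

Lemma dcoefnn n m : (n < p)%N -> (m < p)%N -> dcoef n m n m = 1.
Proof.
move=> np mp; rewrite /dcoef !qbinn; [|exact: wM_expr_neq1|exact: wP_expr_neq1].
by rewrite subnn mul0n muln0 expr0 divr1 mulr1.
Qed.

(** Terms with different [(k, j)] have different eta exponents in the first leg, so at most one of
    them reaches a given coordinate. *)
Lemma DeltaA_coord (a i : AEidx p) : (DeltaA (AEmon hq a) : A2) i =
  if [&& i.1.1 <= a.1.1, i.1.2 <= a.1.2 &
      (a.1.1 - i.1.1 + (a.1.2 - i.1.2) * p.-1 + a.2) %% p == i.2 :> nat]%N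
  then dcoef a.1.1 a.1.2 i.1.1 i.1.2 *: mon (a.1.1 - i.1.1) (a.1.2 - i.1.2) a.2 else 0.
Proof.
rewrite DeltaA_mon_expand sum_ffunE.
have E (k : 'I_a.1.1.+1) : (\sum_(j < a.1.2.+1) dcoef a.1.1 a.1.2 k j *:
    (pure (k : nat, j : nat, (a.1.1 - k + (a.1.2 - j) * p.-1 + a.2))%N
      (mon (a.1.1 - k) (a.1.2 - j) a.2) : A2)) i =
  \sum_(j < a.1.2.+1) if [&& k == i.1.1 :> nat, j == i.1.2 :> nat &
      (a.1.1 - k + (a.1.2 - j) * p.-1 + a.2) %% p == i.2 :> nat]%N
    then dcoef a.1.1 a.1.2 k j *: mon (a.1.1 - k) (a.1.2 - j) a.2 else 0.
  rewrite sum_ffunE; apply: eq_bigr => j _; rewrite !ffunE /reduces_to /=.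
  by case: ifP => _; rewrite ?scaler0.
under eq_bigr do rewrite E; case: (leqP i.1.1 a.1.1) => [ka|ka]; last first.
  rewrite big1 // => k _; rewrite big1 // => j _; case: eqP => //= ki.
  by have := ltn_ord k; rewrite ki ltnS leqNgt ka.
rewrite (bigD1 (Ordinal (ka : i.1.1 < a.1.1.+1)%N)) //= [X in _ + X]big1 ?addr0; last first.
  move=> k /eqP ki; rewrite big1 // => j _; case: eqP => //= kE.
  by case: ki; apply: val_inj.
rewrite eqxx /=; case: (leqP i.1.2 a.1.2) => [ja|ja]; last first.
  rewrite big1 // => j _; case: eqP => //= ji.
  by have := ltn_ord j; rewrite ji ltnS leqNgt ja.
rewrite (bigD1 (Ordinal (ja : i.1.2 < a.1.2.+1)%N)) //= [X in _ + X]big1 ?addr0 ?eqxx //.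
move=> j /eqP ji; case: eqP => //= jE.
by case: ji; apply: val_inj.
Qed.
End CoproductCoordinates.

(** * Invariance on the finite algebra, and the bidegree argument *)

Section Bidegree.
Variables (K : fieldType) (p : nat) (q : K) (hq : p.-primitive_root q).
Hypothesis podd : odd p.
Hypothesis p_ge3 : (3 <= p)%N.
Local Notation A := (AE hq).
Local Notation A2 := (AE2 hq).
Local Notation pure := (AEt_pure hq).

Let p_gt0 : (0 < p)%N. Proof. exact: prim_order_gt0 hq. Qed.
Let p1_lt : (p.-1 < p)%N. Proof. by rewrite prednK. Qed.

Definition idx0 : AEidx p := (Ordinal p_gt0, Ordinal p_gt0, Ordinal p_gt0).
Definition idx_top : AEidx p := (Ordinal p1_lt, Ordinal p1_lt, Ordinal p_gt0).

Lemma AEidxP (i j : AEidx p) :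
  (i == j) = [&& i.1.1 == j.1.1 :> nat, i.1.2 == j.1.2 :> nat & i.2 == j.2 :> nat].
Proof. by case: i j => [[? ?] ?] [[? ?] ?]; rewrite !xpair_eqE /= andbA. Qed.

Lemma AE_oneE (i : AEidx p) : (1 : A) i = (i == idx0)%:R.
Proof.
rewrite [LHS]ffunE AEidxP /reduces_to /= mod0n ![(0 == _)%N]eq_sym.
by case: ifP.
Qed.

Lemma AEmon_coord (c : AEidx p -> K) j : (\sum_i c i *: AEmon hq i) j = c j.
Proof.
rewrite sum_ffunE (bigD1 j) //= ffunE AEmonE eqxx big1 ?addr0; first exact: mulr1.
by move=> i /negPf ij; rewrite ffunE AEmonE ij scaler0.
Qed.

Lemma AE_scaleE (c : K) (x : A) i : (c *: x : A) i = c * x i.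
Proof. exact: ffunE. Qed.
Lemma AE_zeroE i : (0 : A) i = 0.
Proof. exact: ffunE. Qed.

Lemma IAE (x : A) : IA x = x idx_top * q^-1.
Proof.
rewrite /IA (bigD1 idx_top) //= !eqxx /= !mulr1 big1 ?addr0 // => i.
rewrite AEidxP /= [(_ == 0 %[mod p])%N]/= mod0n modn_small //.
case: (_ == p.-1)%N => /=; last by rewrite mulr0 !mul0r mulr0.
case: (_ == p.-1)%N => /=; last by rewrite !mulr0 mul0r mulr0.
by move=> /negPf->; rewrite !mulr0.
Qed.

Lemma DeltaAE (x : A) i : (DeltaA x : A2) i = \sum_a x a *: (DeltaA (AEmon hq a) : A2) i.
Proof.
by rewrite -[in LHS](DeltaA_decomp x) sum_ffunE; apply: eq_bigr => a _; rewrite ffunE.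
Qed.

Let mon_coord n m k (i : AEidx p) : mon hq n m k i = (reduces_to (n, m, k) i)%:R.
Proof. by rewrite ffunE; case: ifP. Qed.

(** Left invariance of [IA], read in coordinate [i]. A second leg with both exponents p - 1 occurs
    only when the monomial has both exponents p - 1 and nothing is moved to the first leg. *)
Lemma IA_DeltaA_left (x : A) (i : AEidx p) : IA ((DeltaA x : A2) i) = IA x * (1 : A) i.
Proof.
rewrite DeltaAE IAE IAE AE_oneE sum_ffunE mulrAC; congr (_ * _).
have ord_le (k : 'I_p) : (k <= p.-1)%N by rewrite -ltnS prednK // ltn_ord.
rewrite (bigD1 idx_top) //= [X in _ + X]big1 ?addr0 => [|a]; last first.
  rewrite AEidxP /= AE_scaleE DeltaA_coord // => ha.
  case: ifP => [/and3P[h1 h2 _]|_]; last by rewrite AE_zeroE mulr0.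
  rewrite AE_scaleE mon_coord /reduces_to /=.
  case: eqP => [e1|_]; last by rewrite !mulr0.
  case: eqP => [e2|_]; last by rewrite !mulr0.
  case: eqP => [e3|_]; last by rewrite !mulr0.
  move: ha; rewrite -(modn_small (ltn_ord a.2)) e3 eqxx andbT; case/negP.
  by rewrite !eqn_leq !ord_le -{1}e1 -{1}e2 !leq_subr.
rewrite AE_scaleE DeltaA_coord //=; congr (_ * _).
(* The powers of delta left in the first leg cancel, since (p - 1) + (p - 1)^2 is a multiple of p;
   hence that leg is the unit. *)
have mod0 : (((p.-1 - 0) + (p.-1 - 0) * p.-1 + 0) %% p = 0)%N.
  by rewrite !subn0 addn0 -mulSn prednK // modnMr.
have [->|i0] := eqVneq i idx0.
  rewrite /= mod0 eqxx /= AE_scaleE mon_coord /reduces_to /= !subn0 !eqxx mod0n.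
  by rewrite dcoef00 // mulr1.
case: ifP => [/and3P[h1 h2 /eqP h3]|_]; last by rewrite AE_zeroE.
rewrite AE_scaleE mon_coord /reduces_to /= mod0n eqxx andbT.
have e k : (k <= p.-1)%N -> (p.-1 - k == p.-1)%N = (k == 0)%N.
  by move=> kp; rewrite -{2}[p.-1]subn0 eqn_sub2lE.
rewrite !e //; move: i0 h3; rewrite AEidxP /=.
case: eqP => [->|_] /=; last by rewrite mulr0.
case: eqP => [->|_] /=; last by rewrite mulr0.
by rewrite mod0 => /negP h /esym/eqP.
Qed.

(** Right invariance of [IA]: if the first leg takes all the etas, the second is a power of delta,
    and the delta exponent of the first leg forces this power to be trivial. *)
Lemma DeltaA_coord_top (x : A) (j : AEidx p) :
  ((DeltaA x : A2) idx_top : A) j = x idx_top * (1 : A) j.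
Proof.
rewrite DeltaAE sum_ffunE (bigD1 idx_top) //= [X in _ + X]big1 ?addr0 => [|a]; last first.
  rewrite AEidxP /= AE_scaleE DeltaA_coord // => ha.
  case: ifP => [/and3P[/= h1 h2]|_]; last by rewrite AE_zeroE mulr0.
  have ord_le (k : 'I_p) : (k <= p.-1)%N by rewrite -ltnS prednK // ltn_ord.
  have e1 : a.1.1 = p.-1 :> nat by apply/eqP; rewrite eqn_leq ord_le.
  have e2 : a.1.2 = p.-1 :> nat by apply/eqP; rewrite eqn_leq ord_le.
  rewrite e1 e2 !subnn mul0n !add0n modn_small // => e3.
  by move: ha; rewrite e1 e2 e3 !eqxx.
rewrite AE_scaleE DeltaA_coord //= !leqnn !subnn mul0n !add0n mod0n eqxx /=.
by rewrite AE_scaleE dcoefnn // mul1r.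
Qed.

(** Exponents are added over the two legs, delta counts as degree 0, and 0 is homogeneous of every
    bidegree. *)
Definition homog (d e : nat) (X : A2) := forall i j : AEidx p,
  (X i : A) j != 0 -> (i.1.1 + j.1.1 = d)%N /\ (i.1.2 + j.1.2 = e)%N.

(** Only pairs of exponents adding up to [l] contribute to coordinate [l] of a product. The
    coefficient algebra is arbitrary because [homogM] applies this once to each leg. *)
Lemma AEt_mul_closed (B : algType K) (Q : B -> Prop) (x y : AEt hq B) (l : AEidx p) : Q 0 ->
  (forall c b b', Q b -> Q b' -> Q (c *: b + b')) ->
  (forall i j : AEidx p, (l.1.1 = i.1.1 + j.1.1 :> nat)%N -> (l.1.2 = i.1.2 + j.1.2 :> nat)%N ->
    Q (x i * y j)) ->
  Q ((x * y) l).
Proof.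
move=> Q0 QD Qxy; rewrite [x * y]/(AEt_mul x y) sum_ffunE.
have QS (I : finType) (F : I -> B) : (forall i, Q (F i)) -> Q (\sum_i F i).
  move=> QF; apply: big_ind => // b b' Qb Qb'.
  by rewrite -[b]scale1r; exact: QD.
apply/QS => i; rewrite sum_ffunE; apply/QS => j; rewrite !ffunE.
case: ifP => [/and3P[/eqP /= h1 /eqP /= h2 _]|_]; last by rewrite scaler0.
by rewrite -[_ *: _]addr0; apply: QD => //; apply: Qxy.
Qed.

Lemma homogM d e d' e' X Y : homog d e X -> homog d' e' Y ->
  homog (d + d') (e + e') (X * Y).
Proof.
move=> hX hY i' j'.
apply: (@AEt_mul_closed _ (fun b : A => b j' != 0 ->
  (i'.1.1 + j'.1.1 = d + d')%N /\ (i'.1.2 + j'.1.2 = e + e')%N) X Y i').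
- by rewrite ffunE eqxx.
- move=> c b b' hb hb'; rewrite !ffunE => h.
  have [b0|/hb //] := eqVneq (b j') 0; apply: hb'.
  by move: h; rewrite b0 scaler0 add0r.
move=> i j e1 e2.
apply: (@AEt_mul_closed _ (fun c : K^o => c != 0 ->
  (i'.1.1 + j'.1.1 = d + d')%N /\ (i'.1.2 + j'.1.2 = e + e')%N) (X i) (Y j) j').
- by rewrite eqxx.
- move=> c b b' hb hb' h.
  have [b0|/hb //] := eqVneq b 0; apply: hb'.
  by move: h; rewrite b0 scaler0 add0r.
move=> k l e3 e4; rewrite mulf_eq0 negb_or => /andP[/hX[f1 f2] /hY[f3 f4]].
by rewrite e1 e2 e3 e4 -f1 -f2 -f3 -f4; split; rewrite addnACA.
Qed.

Lemma homogD d e (c : K) X Y : homog d e X -> homog d e Y -> homog d e (c *: X + Y).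
Proof.
move=> hX hY i j; rewrite !ffunE => h; have [b0|/hX //] := eqVneq ((X i : A) j) 0.
by apply: hY; move: h; rewrite b0 scaler0 add0r.
Qed.

Lemma homog0 d e : homog d e 0.
Proof. by move=> i j; rewrite !ffunE eqxx. Qed.

Lemma homogZ d e (c : K) X : homog d e X -> homog d e (c *: X).
Proof. by move=> hX; rewrite -[_ *: _]addr0; apply: homogD => //; exact: homog0. Qed.

Lemma homog_sum d e (I : Type) (r : seq I) (P : pred I) (F : I -> A2) :
  (forall i, P i -> homog d e (F i)) -> homog d e (\sum_(i <- r | P i) F i).
Proof.
move=> hF; apply: big_ind => //; first exact: homog0.
by move=> X Y hX hY; rewrite -[X]scale1r; exact: homogD.
Qed.

Lemma homog_pure s t : homog (s.1.1 + t.1.1) (s.1.2 + t.1.2) (pure s (pure t 1 : A)).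
Proof.
move=> i j; rewrite ffunE; case: ifP => [/and3P[/eqP-> /eqP-> _]|_]; last first.
  by rewrite ffunE eqxx.
rewrite ffunE; case: ifP => [/and3P[/eqP-> /eqP-> _] //|_].
by rewrite eqxx.
Qed.

Lemma homogX d e X n : homog d e X -> homog (n * d) (n * e) (X ^+ n).
Proof.
move=> hX; elim: n => [|n IH]; last by rewrite exprS !mulSn; exact: homogM.
by rewrite expr0 !mul0n; exact: (@homog_pure (0, 0, 0)%N (0, 0, 0)%N).
Qed.

Lemma homog_overflow d e X : homog d e X -> (2 * p.-1 < d)%N || (2 * p.-1 < e)%N -> X = 0.
Proof.
move=> hX de; apply: AEtP => i; apply: AEtP => j; rewrite !ffunE; apply/eqP.
apply: contraT => /hX[dE eE]; move: de; rewrite -dE -eE !ltnNge -negb_and.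
have ord_le (k : 'I_p) : (k <= p.-1)%N by rewrite -ltnS prednK // ltn_ord.
by rewrite mul2n -addnn !leq_add ?ord_le.
Qed.

Lemma homog_DeltaA (a : AEidx p) : homog a.1.1 a.1.2 (DeltaA (AEmon hq a)).
Proof.
have hP : homog 1 0 (Delta_etaP hq).
  rewrite Delta_etaPE -[pure _ 1]scale1r; apply: homogD.
    exact: (@homog_pure (1, 0, 0)%N (0, 0, 0)%N).
  exact: (@homog_pure (0, 0, 1)%N (1, 0, 0)%N).
have hM : homog 0 1 (Delta_etaM hq).
  rewrite Delta_etaME -[pure _ 1]scale1r; apply: homogD.
    exact: (@homog_pure (0, 1, 0)%N (0, 0, 0)%N).
  exact: (@homog_pure (0, 0, p.-1)%N (0, 1, 0)%N).
have hD : homog 0 0 (Delta_delta hq).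
  by rewrite Delta_deltaE; exact: (@homog_pure (0, 0, 1)%N (0, 0, 1)%N).
rewrite DeltaA_mon.
have := homogM (homogM (@homogX _ _ _ a.1.1 hP) (@homogX _ _ _ a.1.2 hM)) (@homogX _ _ _ a.2 hD).
by rewrite !muln0 !muln1 !addn0 add0n.
Qed.

Let etaP_deltaE n k : etaP hq ^+ n * delta hq ^+ k = pure (n, 0, k)%N 1.
Proof. by rewrite -monE expr0 mulr1. Qed.
Let etaM_deltaVE n k : etaM hq ^+ n * deltaV hq ^+ k = pure (0, n, p.-1 * k)%N 1.
Proof. by rewrite /deltaV -exprM -monE expr0 mul1r. Qed.

Lemma BPE : BP hq = \sum_(1 <= n < p)
  ((-1) ^+ (p.+1)./2 * (q ^+ (n ^ 2) / (qfact q (p - n) * qfact q n))) *: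
    (pure (p - n, 0, n)%N (mon hq n 0 0) : A2).
Proof.
rewrite /BP scaler_sumr; apply: eq_bigr => n _.
by rewrite scalerA etaP_deltaE tens_pure etaP_exp.
Qed.

Lemma BME : BM hq = \sum_(1 <= n < p)
  ((-1) ^+ (p.+1)./2 * (q ^- (n ^ 2) / (qfact q (p - n) * qfact q n))) *:
    (pure (0, p - n, p.-1 * n)%N (mon hq 0 n 0) : A2).
Proof.
rewrite /BM scaler_sumr; apply: eq_bigr => n _.
by rewrite scalerA etaM_deltaVE tens_pure etaM_exp.
Qed.

Lemma homog_BP : homog p 0 (BP hq).
Proof.
rewrite BPE big_nat; apply: homog_sum => n /andP[n0 np]; apply: homogZ.
have := @homog_pure (p - n, 0, n)%N (n, 0, 0)%N.
by rewrite /= subnK // ltnW.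
Qed.

Lemma homog_BM : homog 0 p (BM hq).
Proof.
rewrite BME big_nat; apply: homog_sum => n /andP[n0 np]; apply: homogZ.
have := @homog_pure (0, p - n, p.-1 * n)%N (0, n, 0)%N.
by rewrite /= subnK // ltnW.
Qed.

Lemma qfact_neq0 n : (n < p)%N -> qfact q n != 0.
Proof.
have q0 := prim_root_neq0 hq.
have num j : (0 < j < p)%N -> q ^+ j - q ^- j != 0.
  move=> jp; apply: contra (q2_expr_neq1 hq podd jp).
  rewrite subr_eq0 => /eqP h; rewrite mul2n -addnn exprD {2}h mulfV //.
  exact: expf_neq0.
move=> np; rewrite /qfact big_nat; apply: (big_ind (fun x : K => x != 0)) => [|x y|j /andP[j0 jn]].
- exact: oner_neq0.
- exact: mulf_neq0.
rewrite /qnum mulf_neq0 ?invr_neq0 ?num // ?j0 ?(leq_trans jn) //.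
by have := num 1%N; rewrite expr1 (leq_trans _ p_ge3) //; apply.
Qed.

(** Common to both signs: the first factor is the expanded coproduct of [etaP ^+ p.-1] or
    [etaM ^+ p.-1], the second is the B of the other sign, and [i] is a first leg reached only by
    the pair [k = 0], [n = p.-1]. *)
Lemma mul_extremal_coord m (c d : nat -> K) (s t : nat -> nat * nat * nat) (u v : nat -> A) (i : AEidx p) :
  (forall k n, (0 < n < p)%N -> reduces_to (addexp (s k) (t n)) i -> k = 0%N /\ n = p.-1) ->
  reduces_to (addexp (s 0%N) (t p.-1)) i ->
  ((\sum_(k < m.+1) c k *: (pure (s k) (u k) : A2)) *
    (\sum_(1 <= n < p) d n *: (pure (t n) (v n) : A2))) i =
  (c 0%N * d p.-1 * twist q (s 0%N) (t p.-1)) *: (u 0%N * v p.-1).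
Proof.
move=> hred red0.
have -> : \sum_(1 <= n < p) d n *: (pure (t n) (v n) : A2) =
    \sum_(n < p.-1) d n.+1 *: (pure (t n.+1) (v n.+1) : A2).
  by rewrite big_add1 big_mkord.
rewrite (sum_mul2 (D := A2)) sum_ffunE.
have E k n : ((c k *: (pure (s k) (u k) : A2)) * (d n *: (pure (t n) (v n) : A2))) i =
    if reduces_to (addexp (s k) (t n)) i
    then (c k * d n * twist q (s k) (t n)) *: (u k * v n) else 0.
  rewrite -scalerAl -scalerAr pureM !scalerA !ffunE.
  by case: ifP => _; rewrite ?scaler0.
rewrite big_ord_recl [X in _ + X]big1 ?addr0; last first.
  move=> k _; rewrite sum_ffunE big1 // => n _; rewrite E; case: ifP => // h.
  have [|//] := hred _ n.+1 _ h; by rewrite /= -ltn_predRL ltn_ord.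
(* After the shift of the summation index, [p.-2] stands for [n = p.-1]. *)
have p2 : (p.-2 < p.-1)%N by case: p p_ge3 => [|[|]].
rewrite sum_ffunE (bigD1 (Ordinal p2)) //= big1 ?addr0.
  rewrite E prednK ?red0 //; by case: p p_ge3 => [|[|]].
move=> n /eqP np; rewrite E; case: ifP => // h.
have [|_ e] := hred _ n.+1 _ h; first by rewrite /= -ltn_predRL ltn_ord.
by case: np; apply: val_inj => /=; apply: succn_inj; rewrite e prednK // -ltnS prednK //; exact: ltnW.
Qed.

End Bidegree.

(** * Products of coproducts with B_+ and B_- *)

Section BCoordinates.
Variables (K : fieldType) (p : nat) (q : K) (hq : p.-primitive_root q).
Hypothesis podd : odd p.
Hypothesis p_ge3 : (3 <= p)%N.
Local Notation A := (AE hq).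
Local Notation A2 := (AE2 hq).
Local Notation pure := (AEt_pure hq).

Let p_gt0 : (0 < p)%N. Proof. exact: prim_order_gt0 hq. Qed.
Let p1_gt0 : (0 < p.-1)%N. Proof. by rewrite -ltnS prednK // ltnW. Qed.
Let p1_lt : (p.-1 < p)%N. Proof. by rewrite prednK. Qed.

Let overflow : (2 * p.-1 < p.-1 + p)%N.
Proof. by rewrite mul2n -addnn ltn_add2l. Qed.

Lemma DeltaA_BP_eq0 (a : AEidx p) : a.1.1 = p.-1 :> nat ->
  (DeltaA (AEmon hq a) : A2) * BP hq = 0.
Proof.
move=> ha; apply: (homog_overflow (homogM (@homog_DeltaA _ _ _ hq a) (@homog_BP _ _ _ hq))).
by rewrite ha overflow.
Qed.

Lemma DeltaA_BM_eq0 (a : AEidx p) : a.1.2 = p.-1 :> nat ->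
  (DeltaA (AEmon hq a) : A2) * BM hq = 0.
Proof.
move=> ha; apply: (homog_overflow (homogM (@homog_DeltaA _ _ _ hq a) (@homog_BM _ _ _ hq))).
by rewrite ha overflow orbT.
Qed.

Lemma DeltaA_BPM_eq0 (a : AEidx p) : a.1.1 = p.-1 :> nat \/ a.1.2 = p.-1 :> nat ->
  (DeltaA (AEmon hq a) : A2) * (BP hq * BM hq) = 0.
Proof.
move=> ha; apply: (homog_overflow (homogM (@homog_DeltaA _ _ _ hq a)
  (homogM (@homog_BP _ _ _ hq) (@homog_BM _ _ _ hq)))).
by rewrite addn0 add0n; case: ha => ->; rewrite overflow ?orbT.
Qed.

Definition idxP : AEidx p := (Ordinal p1_lt, Ordinal p_gt0, Ordinal p_gt0).
Definition idxM : AEidx p := (Ordinal p_gt0, Ordinal p1_lt, Ordinal p_gt0).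

Let sub_eq1 n : (0 < n < p)%N -> (p - n == 1)%N -> n = p.-1.
Proof.
move=> /andP[_ np] /eqP e; have := subnK (ltnW np); rewrite e add1n => <-.
by [].
Qed.
Let subp1 : (p - p.-1 = 1)%N. Proof. by rewrite -{1}(prednK p_gt0) subSnn. Qed.

Let q0 := prim_root_neq0 hq.
Let q_fact (n : nat) : (0 < n < p)%N -> qfact q (p - n) * qfact q n != 0.
Proof.
move=> /andP[n0 np]; apply: mulf_neq0; apply: (qfact_neq0 hq) => //.
by rewrite ltn_subrL n0.
Qed.

(** The term of the coproduct with [etaM ^+ p.-1] entirely in the second leg meets the term
    [n = p.-1] of B_+, whose legs contain [etaP] and [etaP ^+ p.-1]. The first leg of the product
    contains one [etaP], so this coordinate is absent from the coproduct itself. *)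
Lemma DeltaA_BP_coord : exists (i : AEidx p) (c : K), [/\ c != 0, i != idx0 hq,
  (DeltaA (AEmon hq idxM) : A2) i = 0 &
  ((DeltaA (AEmon hq idxM) : A2) * BP hq) i = c *: AEmon hq (idx_top hq)].
Proof.
have p1p : (1 < p)%N by exact: ltnW.
pose i : AEidx p := (Ordinal p1p, Ordinal p_gt0, Ordinal (ltn_pmod (p.-1 * p.-1 + p.-1) p_gt0)).
pose d n : K := (-1) ^+ (p.+1)./2 * (q ^+ (n ^ 2) / (qfact q (p - n) * qfact q n)).
pose s (k : nat) := (0, k, (p.-1 - k) * p.-1)%N; pose t (n : nat) := (p - n, 0, n)%N.
(* Besides the two coefficients, one [twist] reorders the first leg and the other brings
   [etaM ^+ p.-1 * etaP ^+ p.-1] in the second leg to normal order. *)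
exists i, (qbin (wM p q) p.-1 0 * d p.-1 * twist q (s 0%N) (t p.-1) *
  twist q (0, p.-1, 0)%N (p.-1, 0, 0)%N).
split.
- rewrite qbin0; last exact: wM_expr_neq1.
  have tw u v : twist q u v != 0 by rewrite /twist mulf_neq0 ?invr_neq0 ?expf_neq0.
  have d0 : d p.-1 != 0.
    apply: mulf_neq0; first by rewrite expf_neq0 // oppr_eq0 oner_neq0.
    by apply: mulf_neq0; rewrite ?invr_neq0 ?expf_neq0 // q_fact // p1_gt0.
  rewrite mul1r; apply: mulf_neq0; last exact: tw.
  by apply: mulf_neq0; last exact: tw.
- by rewrite AEidxP.
- by rewrite DeltaA_coord.
rewrite DeltaA_mon !expr0 mul1r mulr1 Delta_etaM_exp // BPE.
rewrite (@mul_extremal_coord _ _ _ _ p_ge3 _ (qbin (wM p q) p.-1) d s t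
  (fun k => etaM hq ^+ (p.-1 - k)) (fun n => mon hq n 0 0)) //.
- rewrite subn0 etaM_exp pureM scalerA mulr1 AEmonE' /addexp /=.
  by rewrite !add0n !addn0.
- move=> k n np /and3P[/= h1 h2 _]; split.
    by move: h2; rewrite addn0 => /eqP.
  by apply: sub_eq1.
- by rewrite /reduces_to /= subp1 subn0 !eqxx.
Qed.

(** The mirror image; here the second leg [etaP ^+ p.-1 * etaM ^+ p.-1] is already in normal order,
    hence one [twist] fewer. *)
Lemma DeltaA_BM_coord : exists (i : AEidx p) (c : K), [/\ c != 0, i != idx0 hq,
  (DeltaA (AEmon hq idxP) : A2) i = 0 &
  ((DeltaA (AEmon hq idxP) : A2) * BM hq) i = c *: AEmon hq (idx_top hq)].
Proof.
have p1p : (1 < p)%N by exact: ltnW.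
pose i : AEidx p := (Ordinal p_gt0, Ordinal p1p, Ordinal (ltn_pmod (p.-1 + p.-1 * p.-1) p_gt0)).
pose d n : K := (-1) ^+ (p.+1)./2 * (q ^- (n ^ 2) / (qfact q (p - n) * qfact q n)).
pose s (k : nat) := (k, 0, p.-1 - k)%N; pose t (n : nat) := (0, p - n, p.-1 * n)%N.
exists i, (qbin (wP q) p.-1 0 * d p.-1 * twist q (s 0%N) (t p.-1)).
split.
- rewrite qbin0; last exact: (wP_expr_neq1 hq podd p1_lt).
  have tw u v : twist q u v != 0 by rewrite /twist mulf_neq0 ?invr_neq0 ?expf_neq0.
  have d0 : d p.-1 != 0.
    apply: mulf_neq0; first by rewrite expf_neq0 // oppr_eq0 oner_neq0.
    by apply: mulf_neq0; rewrite ?invr_neq0 ?expf_neq0 // q_fact // p1_gt0.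
  by rewrite mul1r; apply: mulf_neq0; last exact: tw.
- by rewrite AEidxP.
- by rewrite DeltaA_coord //= andbF.
have aE : DeltaA (AEmon hq idxP) = Delta_etaP hq ^+ p.-1.
  by rewrite DeltaA_mon (expr0 (Delta_etaM hq)) (expr0 (Delta_delta hq)) !mulr1.
rewrite aE Delta_etaP_exp // BME.
rewrite (@mul_extremal_coord _ _ _ _ p_ge3 _ (qbin (wP q) p.-1) d s t
  (fun k => etaP hq ^+ (p.-1 - k)) (fun n => mon hq 0 n 0)) //.
- rewrite subn0 etaP_exp pureM mulr1 AEmonE' /addexp /twist /=.
  by rewrite !muln0 expr0 divr1 scale1r !add0n !addn0.
- move=> k n np /and3P[/= h1 h2 _]; split.
    by move: h1; rewrite addn0 => /eqP.
  by apply: sub_eq1.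
- by rewrite /reduces_to /= subp1 subn0 !eqxx.
Qed.
End BCoordinates.

(** * Invariance of the integral *)

Section Invariance.
Variables (R : realType) (p : nat) (q : R[i]) (hq : p.-primitive_root q).
Hypothesis podd : odd p.
Local Notation C := R[i].
Local Notation plane := (R * R)%type.
Local Notation A := (AE hq).
Local Notation A2 := (AE2 hq).
Implicit Types (F G : plane -> A) (f : plane -> C).

Lemma Csmooth_c0 : Csmooth_c (fun _ : plane => 0 : C).
Proof.
apply/Csmooth_cP; have t0 : test (cst 0 : plane -> R).
  by split=> [|b]; [exact: Rsmooth_cst|exists 0].
by split.
Qed.

Lemma IC0 : IC (fun _ : plane => 0 : C) = 0.
Proof.
have c0 := Csmooth_c0; have := IC_lin 1 c0 c0.
rewrite (_ : (fun z => _) = fun=> 0).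
  by rewrite mul1r => /esym/(canRL (addrK _)); rewrite subrr.
by apply/funext => z; rewrite mulr0 addr0.
Qed.

Lemma Csmooth_cZ (c : C) f : Csmooth_c f -> Csmooth_c (fun z => c * f z).
Proof.
move=> cf; have := Csmooth_c_lin c cf Csmooth_c0.
by under [X in Csmooth_c X -> _]eq_fun do rewrite addr0.
Qed.

Lemma ICZ (c : C) f : Csmooth_c f -> IC (fun z => c * f z) = c * IC f.
Proof.
move=> cf; have := IC_lin c cf Csmooth_c0.
by under [X in IC X = _ -> _]eq_fun do rewrite addr0; rewrite IC0 addr0.
Qed.

Lemma Csmooth_c_sum (I : Type) (r : seq I) (f : I -> plane -> C) :
  (forall k, Csmooth_c (f k)) -> Csmooth_c (fun z => \sum_(k <- r) f k z).
Proof.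
move=> cf; elim: r => [|k r IH].
  by under eq_fun do rewrite big_nil; exact: Csmooth_c0.
have := Csmooth_c_lin 1 (cf k) IH.
by under [X in Csmooth_c X -> _]eq_fun do rewrite mul1r -(big_cons 0 +%R k r xpredT).
Qed.

Lemma IC_sum (I : Type) (r : seq I) (f : I -> plane -> C) :
  (forall k, Csmooth_c (f k)) ->
  IC (fun z => \sum_(k <- r) f k z) = \sum_(k <- r) IC (f k).
Proof.
move=> cf; elim: r => [|k r IH].
  by under eq_fun do rewrite big_nil; rewrite big_nil IC0.
have := IC_lin 1 (cf k) (Csmooth_c_sum r cf).
under [X in IC X = _ -> _]eq_fun do rewrite mul1r -(big_cons 0 +%R k r xpredT).
by move=> ->; rewrite big_cons IH mul1r.
Qed.

(** Coordinates in the monomial basis replace the unspecified representation of [F]. *)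
Lemma inA0P F : inA0 F <-> forall i, Csmooth_c (fun z => F z i).
Proof.
split=> [[n [a [f [cf ->]]]] i|cF].
  rewrite (_ : (fun z => _) = fun z => \sum_k a k i * f k z).
    by apply: Csmooth_c_sum => k; exact: Csmooth_cZ.
  apply/funext => z; rewrite sum_ffunE; apply: eq_bigr => k _.
  by rewrite AE_scaleE mulrC.
exists #|AEidx p|, (fun k => AEmon hq (enum_val k)), (fun k z => F z (enum_val k)).
split=> // ; apply/funext => z.
rewrite [LHS]AEmon_decomp (reindex (@enum_val _ (AEidx p))) //=.
exact: onW_bij (@enum_val_bij (AEidx p)).
Qed.

Lemma inA0_lin (c : C) F G : inA0 F -> inA0 G -> inA0 (fun z => c *: F z + G z).
Proof.
move=> /inA0P cF /inA0P cG; apply/inA0P => i.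
rewrite (_ : (fun z => _) = fun z => c * F z i + G z i); first exact: Csmooth_c_lin.
by apply/funext => z; rewrite ffunE AE_scaleE.
Qed.

Lemma inA0_scale f (x : A) : Csmooth_c f -> inA0 (fun z => f z *: x).
Proof.
move=> cf; apply/inA0P => i; rewrite (_ : (fun z => _) = fun z => x i * f z).
  exact: Csmooth_cZ.
by apply/funext => z; rewrite AE_scaleE mulrC.
Qed.

Lemma IEE F : IE F = IC (fun z => F z (idx_top hq)) * q^-1.
Proof.
rewrite /IE (bigD1 (idx_top hq)) //= big1 ?addr0 => [|i /negPf it].
  by rewrite IAE AEmonE eqxx mul1r mulrC.
by rewrite IAE AEmonE it !mul0r.
Qed.

Lemma mul_lin4 (D : algType C) (x b1 b2 b3 : D) (c0 c1 c2 c3 : C) :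
  x * (c0 *: 1 + c1 *: b1 + c2 *: b2 + c3 *: b3) =
  c0 *: x + c1 *: (x * b1) + c2 *: (x * b2) + c3 *: (x * b3).
Proof. by rewrite !mulrDr -!scalerAr mulr1. Qed.

Lemma Delta_monE (a : AEidx p) f (z' z'' : plane) :
  DeltaA (AEmon hq a) * DeltaC hq f z' z'' =
  f (z' + z'') *: (DeltaA (AEmon hq a) : A2)
  + Cderive (ePlus R) f (z' + z'') *: (DeltaA (AEmon hq a) * BP hq : A2)
  + Cderive (eMinus R) f (z' + z'') *: (DeltaA (AEmon hq a) * BM hq : A2)
  + Cderive (ePlus R) (Cderive (eMinus R) f) (z' + z'') *:
      (DeltaA (AEmon hq a) * (BP hq * BM hq) : A2).
Proof. exact: (@mul_lin4 A2). Qed.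

Lemma AE2_coordD (X Y : A2) (i : AEidx p) : (X + Y) i = X i + Y i :> A.
Proof. exact: ffunE. Qed.
Lemma AE2_coordZ (c : C) (X : A2) (i : AEidx p) : (c *: X) i = c *: (X i : A) :> A.
Proof. exact: ffunE. Qed.
Lemma AE_coordD (x y : A) (i : AEidx p) : (x + y) i = x i + y i.
Proof. exact: ffunE. Qed.

Lemma coord4 (c0 c1 c2 c3 : C) (X0 X1 X2 X3 : A2) (i j : AEidx p) :
  ((c0 *: X0 + c1 *: X1 + c2 *: X2 + c3 *: X3 : A2) i : A) j =
  (X0 i : A) j * c0 + (X1 i : A) j * c1 + (X2 i : A) j * c2 + (X3 i : A) j * c3.
Proof.
have cD (X Y : A2) : ((X + Y) i : A) j = (X i : A) j + (Y i : A) j.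
  by rewrite AE2_coordD AE_coordD.
have cZ (c : C) (X : A2) : ((c *: X) i : A) j = (X i : A) j * c.
  by rewrite AE2_coordZ AE_scaleE mulrC.
rewrite (cD (c0 *: X0 + c1 *: X1 + c2 *: X2)) (cD (c0 *: X0 + c1 *: X1)) (cD (c0 *: X0)).
by rewrite 4!cZ.
Qed.

Let Delta_part F (i j : AEidx p) (a : AEidx p) (z : plane) : C :=
  (DeltaA (AEmon hq a) i : A) j * F z a
  + ((DeltaA (AEmon hq a) * BP hq : A2) i : A) j * Cderive (ePlus R) (fun z => F z a) z
  + ((DeltaA (AEmon hq a) * BM hq : A2) i : A) j * Cderive (eMinus R) (fun z => F z a) z
  + ((DeltaA (AEmon hq a) * (BP hq * BM hq) : A2) i : A) j *
      Cderive (ePlus R) (Cderive (eMinus R) (fun z => F z a)) z.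

Lemma Delta_coord F (z' z'' : plane) (i j : AEidx p) :
  (Delta F z' z'' i : A) j = \sum_a Delta_part F i j a (z' + z'').
Proof.
rewrite /Delta sum_ffunE sum_ffunE; apply: eq_bigr => a _.
by rewrite Delta_monE; exact: coord4.
Qed.

Lemma Csmooth_c_deriv2 f : Csmooth_c f -> [/\ Csmooth_c (Cderive (ePlus R) f),
  Csmooth_c (Cderive (eMinus R) f) &
  Csmooth_c (Cderive (ePlus R) (Cderive (eMinus R) f))].
Proof.
move=> cf; have cM := Csmooth_c_derive false cf.
exact: (And3 (Csmooth_c_derive true cf) cM (Csmooth_c_derive true cM)).
Qed.

Lemma Csmooth_c_lin4 (k0 k1 k2 k3 : C) (f0 f1 f2 f3 : plane -> C) :
  Csmooth_c f0 -> Csmooth_c f1 -> Csmooth_c f2 -> Csmooth_c f3 ->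
  Csmooth_c (fun z => k0 * f0 z + k1 * f1 z + k2 * f2 z + k3 * f3 z) /\
  IC (fun z => k0 * f0 z + k1 * f1 z + k2 * f2 z + k3 * f3 z) =
    k0 * IC f0 + k1 * IC f1 + k2 * IC f2 + k3 * IC f3.
Proof.
move=> c0 c1 c2 c3; have e3 := Csmooth_cZ k3 c3.
have e2 := Csmooth_c_lin k2 c2 e3; have e1 := Csmooth_c_lin k1 c1 e2.
rewrite (_ : (fun z => _) =
  fun z => k0 * f0 z + (k1 * f1 z + (k2 * f2 z + k3 * f3 z))); last first.
  by apply/funext => z; rewrite !addrA.
split; first exact: Csmooth_c_lin.
by rewrite (IC_lin k0 c0 e1) (IC_lin k1 c1 e2) (IC_lin k2 c2 e3) (ICZ k3 c3) !addrA.
Qed.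

Lemma Delta_part_smooth F i j a : inA0 F -> Csmooth_c (Delta_part F i j a).
Proof.
move=> /inA0P /(_ a) cf; have [c1 c2 c3] := Csmooth_c_deriv2 cf.
exact: (Csmooth_c_lin4 _ _ _ _ cf c1 c2 c3).1.
Qed.

Lemma IC_Delta_part F i j a : inA0 F ->
  IC (Delta_part F i j a) = (DeltaA (AEmon hq a) i : A) j * IC (fun z => F z a).
Proof.
move=> /inA0P /(_ a) cf; have [c1 c2 c3] := Csmooth_c_deriv2 cf.
apply: etrans (Csmooth_c_lin4 _ _ _ _ cf c1 c2 c3).2 _.
have cM := Csmooth_c_derive false cf.
have kill (k x y z u1 u2 u3 : C) : u1 = 0 -> u2 = 0 -> u3 = 0 ->
    k + x * u1 + y * u2 + z * u3 = k.
  by move=> -> -> ->; rewrite !mulr0 !addr0.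
by apply: kill; [exact: (IC_derive true cf)|exact: (IC_derive false cf)|
  exact: (IC_derive true cM)].
Qed.

(** Integrating over the plane leaves only the coproduct of the finite algebra. The identity is
    stated for each pair of coordinates so as to serve both invariance conditions. *)
Lemma IC_Delta F (w : plane) (i j : AEidx p) : inA0 F ->
  IC (fun z => (Delta F w z i : A) j) =
  \sum_a (DeltaA (AEmon hq a) i : A) j * IC (fun z => F z a).
Proof.
move=> hF; under eq_fun do rewrite Delta_coord.
rewrite IC_sum => [|a]; last exact: Csmooth_c_shift (Delta_part_smooth i j a hF).
apply: eq_bigr => a _.
by rewrite (IC_shift w (Delta_part_smooth i j a hF)) IC_Delta_part.
Qed.

(** The points enter only through their sum. The exchange concerns the points and not the legs, and
    brings the integral over the first point under [IC_Delta]. *)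
Lemma Delta_sym F (z' z'' : plane) : Delta F z' z'' = Delta F z'' z'.
Proof.
by rewrite /Delta; apply: eq_bigr => a _; rewrite /DeltaC [z' + z'']addrC.
Qed.

Lemma AE_scale_one (c : A -> C) (d : C) (x : AEidx p -> C) :
  (forall i, x i = d * (1 : A) i) -> \sum_i x i *: AEmon hq i = d *: 1.
Proof. by move=> h; apply: AEtP => i; rewrite AEmon_coord AE_scaleE. Qed.

Lemma IE_lin : linear_on_A0 (@IE R p q hq).
Proof.
move=> c F G hF hG; rewrite !IEE.
move: hF hG => /inA0P hF /inA0P hG; rewrite mulrA -mulrDl -IC_lin //; congr (IC _ * _).
by apply/funext => z; rewrite AE_coordD AE_scaleE.
Qed.

Lemma IE_invariant : invariant_integral (@IE R p q hq).
Proof.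
split=> [|F hF]; first exact: IE_lin.
have IEF : IE F = \sum_a IA (AEmon hq a) * IC (fun z => F z a) by [].
split=> z; rewrite /id_tensor /tensor_id; apply: (AE_scale_one (fun _ => 0)) => i.
  rewrite IEE IC_Delta // IEF !mulr_suml; apply: eq_bigr => a _.
  have := IA_DeltaA_left podd (AEmon hq a) i; rewrite IAE => h.
  by rewrite mulrAC h mulrAC.
rewrite IEE; under eq_fun do rewrite AEmon_coord Delta_sym.
rewrite IC_Delta // IEF !mulr_suml; apply: eq_bigr => a _.
by rewrite DeltaA_coord_top // IAE; ring.
Qed.
End Invariance.

(** * Uniqueness of the invariant functional *)

Section Uniqueness.
Variables (R : realType) (p : nat) (q : R[i]) (hq : p.-primitive_root q).
Hypothesis podd : odd p.
Hypothesis p_ge3 : (3 <= p)%N.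
Local Notation C := R[i].
Local Notation plane := (R * R)%type.
Local Notation A := (AE hq).
Local Notation A2 := (AE2 hq).
Implicit Types (F G : plane -> A) (f : plane -> C).

Let p_gt0 : (0 < p)%N. Proof. exact: prim_order_gt0 hq. Qed.

Lemma inA0_const0 : inA0 (fun _ : plane => 0 : A).
Proof.
apply/inA0P => i; rewrite (_ : (fun z => _) = fun=> 0); first exact: Csmooth_c0.
by apply/funext => z; rewrite AE_zeroE.
Qed.

Lemma inA0_sum (I : Type) (r : seq I) (F : I -> plane -> A) :
  (forall k, inA0 (F k)) -> inA0 (fun z => \sum_(k <- r) F k z).
Proof.
move=> hF; elim: r => [|k r IH].
  by under eq_fun do rewrite big_nil; exact: inA0_const0.
have := inA0_lin 1 (hF k) IH.
by under [X in inA0 X -> _]eq_fun do rewrite scale1r -(big_cons 0 +%R k r xpredT).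
Qed.

Variable phi : (plane -> A) -> C.
Hypothesis phi_lin : linear_on_A0 phi.

Lemma linear_on_A0_0 : phi (fun=> 0) = 0.
Proof.
have := phi_lin 1 inA0_const0 inA0_const0.
under [X in phi X = _ -> _]eq_fun do rewrite scaler0 addr0.
by rewrite mul1r => /esym/(canRL (addrK _)); rewrite subrr.
Qed.

Lemma linear_on_A0_scale (c : C) F : inA0 F -> phi (fun z => c *: F z) = c * phi F.
Proof.
move=> hF; have := phi_lin c hF inA0_const0.
by under [X in phi X = _ -> _]eq_fun do rewrite addr0; rewrite linear_on_A0_0 addr0.
Qed.

Lemma linear_on_A0_sum (I : Type) (r : seq I) (F : I -> plane -> A) :
  (forall k, inA0 (F k)) ->
  phi (fun z => \sum_(k <- r) F k z) = \sum_(k <- r) phi (F k).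
Proof.
move=> hF; elim: r => [|k r IH].
  by under eq_fun do rewrite big_nil; rewrite big_nil linear_on_A0_0.
have := phi_lin 1 (hF k) (inA0_sum r hF).
under [X in phi X = _ -> _]eq_fun do rewrite scale1r -(big_cons 0 +%R k r xpredT).
by move=> ->; rewrite big_cons IH mul1r.
Qed.

Hypothesis phi_inv : forall F, inA0 F ->
  id_tensor phi (Delta F) (0 : plane) = phi F *: 1.

(** Used for [i] different from [idx0 hq], where the right-hand side is 0 and a linear condition on
    [phi] remains. *)
Lemma invariant_coord (a i : AEidx p) f : Csmooth_c f ->
  phi (fun z => (DeltaA (AEmon hq a) * DeltaC hq f 0 z : A2) i) =
  phi (fun z => f z *: AEmon hq a) * (i == idx0 hq)%:R.
Proof.
move=> cf; have hF := inA0_scale (AEmon hq a) cf.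
have := congr1 (fun x : A => x i) (phi_inv hF).
rewrite /id_tensor AEmon_coord AE_scaleE AE_oneE => <-.
have DE : Delta (fun z => f z *: AEmon hq a) =
    fun z' z'' => DeltaA (AEmon hq a) * DeltaC hq f z' z''.
  have := @Delta_sum R p q hq 1 (fun=> AEmon hq a) (fun=> f) (fun=> cf.1).
  under [X in Delta X = _ -> _]eq_fun do rewrite big_ord1.
  move=> ->; apply/funext => z'; apply/funext => z''; exact: big_ord1.
by rewrite DE.
Qed.

Lemma coord_lin4 (c0 c1 c2 c3 : C) (X0 X1 X2 X3 : A2) (i : AEidx p) :
  (c0 *: X0 + c1 *: X1 + c2 *: X2 + c3 *: X3 : A2) i =
  c0 *: (X0 i : A) + c1 *: (X1 i : A) + c2 *: (X2 i : A) + c3 *: (X3 i : A).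
Proof.
rewrite (AE2_coordD (c0 *: X0 + c1 *: X1 + c2 *: X2)) (AE2_coordD (c0 *: X0 + c1 *: X1)).
by rewrite (AE2_coordD (c0 *: X0)) 4!AE2_coordZ.
Qed.

Lemma lin4_single (V : lmodType C) (c0 c1 c2 c3 : C) (x0 x1 x2 x3 : V) :
  [/\ x1 = 0 -> x2 = 0 -> x3 = 0 ->
        c0 *: x0 + c1 *: x1 + c2 *: x2 + c3 *: x3 = c0 *: x0,
      x0 = 0 -> x2 = 0 -> x3 = 0 ->
        c0 *: x0 + c1 *: x1 + c2 *: x2 + c3 *: x3 = c1 *: x1 &
      x0 = 0 -> x1 = 0 -> x3 = 0 ->
        c0 *: x0 + c1 *: x1 + c2 *: x2 + c3 *: x3 = c2 *: x2].
Proof. by split=> -> -> ->; rewrite !scaler0 ?addr0 ?add0r. Qed.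

Lemma AE2_coord0 (i : AEidx p) : (0 : A2) i = 0 :> A.
Proof. exact: ffunE. Qed.

Lemma AE2_eq0_coord (X : A2) (i : AEidx p) : X = 0 -> X i = 0 :> A.
Proof. by move=> ->; exact: AE2_coord0. Qed.

Lemma Delta_mon_coord (a i : AEidx p) f (z : plane) :
  (DeltaA (AEmon hq a) * DeltaC hq f 0 z : A2) i =
  f z *: ((DeltaA (AEmon hq a) : A2) i : A)
  + Cderive (axis R true) f z *: ((DeltaA (AEmon hq a) * BP hq : A2) i : A)
  + Cderive (axis R false) f z *: ((DeltaA (AEmon hq a) * BM hq : A2) i : A)
  + Cderive (axis R true) (Cderive (axis R false) f) z *:
      ((DeltaA (AEmon hq a) * (BP hq * BM hq) : A2) i : A).
Proof. by rewrite Delta_monE -coord_lin4 (add0r z). Qed.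

Lemma invariant_mon_eq0 (b : AEidx p) f : Csmooth_c f -> b != idx_top hq ->
  phi (fun z => f z *: AEmon hq b) = 0.
Proof.
move=> cf b_top.
have p1_lt : (p.-1 < p)%N by rewrite prednK.
have ord_le (k : 'I_p) : (k <= p.-1)%N by rewrite -ltnS prednK // ltn_ord.
have sub_lt k : (p.-1 - k < p)%N by exact: leq_ltn_trans (leq_subr _ _) p1_lt.
pose a : AEidx p := (Ordinal p1_lt, Ordinal p1_lt, b.2).
(* Complementary exponents: the term with this first leg has second leg exactly [b]. Since (p - 1) +
   (p - 1)^2 is a multiple of p, this first leg is the unit only for [b = idx_top hq]. *)
pose i : AEidx p := (Ordinal (sub_lt b.1.1), Ordinal (sub_lt b.1.2),
  Ordinal (ltn_pmod (b.1.1 + b.1.2 * p.-1 + b.2) p_gt0)).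
have i0 : i != idx0 hq.
  apply: contra b_top; rewrite !AEidxP /= !subn_eq0 => /and3P[h1 h2 h3].
  have e1 : b.1.1 = p.-1 :> nat by apply/eqP; rewrite eqn_leq ord_le.
  have e2 : b.1.2 = p.-1 :> nat by apply/eqP; rewrite eqn_leq ord_le.
  move: h3; rewrite e1 e2 -mulSn prednK // mulnC modnMDl modn_small // => ->.
  by rewrite !eqxx.
have := invariant_coord a i cf; rewrite (negPf i0) mulr0.
have -> : (fun z => (DeltaA (AEmon hq a) * DeltaC hq f 0 z : A2) i) =
    fun z => dcoef p q p.-1 p.-1 (p.-1 - b.1.1) (p.-1 - b.1.2) *: (f z *: AEmon hq b).
  apply/funext => z; apply: etrans (Delta_mon_coord a i f z) _.
  have [h _ _] := lin4_single (f z) (Cderive (axis R true) f z) (Cderive (axis R false) f z)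
    (Cderive (axis R true) (Cderive (axis R false) f) z)
    ((DeltaA (AEmon hq a) : A2) i : A) ((DeltaA (AEmon hq a) * BP hq : A2) i : A)
    ((DeltaA (AEmon hq a) * BM hq : A2) i : A)
    ((DeltaA (AEmon hq a) * (BP hq * BM hq) : A2) i : A).
  apply: etrans (h _ _ _) _.
  - exact: AE2_eq0_coord (DeltaA_BP_eq0 hq (a := a) erefl).
  - exact: AE2_eq0_coord (DeltaA_BM_eq0 hq (a := a) erefl).
  - exact: AE2_eq0_coord (DeltaA_BPM_eq0 hq (a := a) (or_introl erefl)).
  rewrite DeltaA_coord //= !leq_subr !subKn //.
  by rewrite eqxx /= scalerA mulrC -scalerA -AEmonE'.
rewrite linear_on_A0_scale; last exact: inA0_scale.
move/eqP; rewrite mulf_eq0 => /orP[|/eqP //].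
by rewrite (negPf (dcoef_neq0 hq podd p1_lt p1_lt (leq_subr _ _) (leq_subr _ _))).
Qed.

(** The roles are crossed: [etaM ^+ p.-1] annihilates B_- and thereby isolates the derivative that
    goes with B_+, and conversely for [etaP ^+ p.-1]. *)
Lemma invariant_derive_eq0 c f : Csmooth_c f ->
  phi (fun z => Cderive (axis R c) f z *: AEmon hq (idx_top hq)) = 0.
Proof.
move=> cf; have cD := Csmooth_c_derive c cf.
suff [i [a [k [k0 i0 E]]]] : exists i a k, [/\ k != 0, i != idx0 hq &
    (fun z => (DeltaA (AEmon hq a) * DeltaC hq f 0 z : A2) i) =
    fun z => k *: (Cderive (axis R c) f z *: AEmon hq (idx_top hq))].
  have := invariant_coord a i cf; rewrite E (negPf i0) mulr0.
  rewrite linear_on_A0_scale; last exact: inA0_scale.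
  by move/eqP; rewrite mulf_eq0 (negPf k0) => /eqP.
case: c cD => cD.
  have [i [k [k0 i0 E0 E1]]] := DeltaA_BP_coord hq podd p_ge3.
  exists i, (idxM hq), k; split=> //; apply/funext => z.
  apply: etrans (Delta_mon_coord (idxM hq) i f z) _.
  have [_ h _] := lin4_single (f z) (Cderive (axis R true) f z) (Cderive (axis R false) f z)
    (Cderive (axis R true) (Cderive (axis R false) f) z)
    ((DeltaA (AEmon hq (idxM hq)) : A2) i : A)
    ((DeltaA (AEmon hq (idxM hq)) * BP hq : A2) i : A)
    ((DeltaA (AEmon hq (idxM hq)) * BM hq : A2) i : A)
    ((DeltaA (AEmon hq (idxM hq)) * (BP hq * BM hq) : A2) i : A).
  apply: etrans (h E0 _ _) _.
  - exact: AE2_eq0_coord (DeltaA_BM_eq0 hq (a := idxM hq) erefl).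
  - exact: AE2_eq0_coord (DeltaA_BPM_eq0 hq (a := idxM hq) (or_intror erefl)).
  by apply: etrans (congr1 _ E1) _; rewrite !scalerA mulrC.
have [i [k [k0 i0 E0 E1]]] := DeltaA_BM_coord hq podd p_ge3.
exists i, (idxP hq), k; split=> //; apply/funext => z.
apply: etrans (Delta_mon_coord (idxP hq) i f z) _.
have [_ _ h] := lin4_single (f z) (Cderive (axis R true) f z) (Cderive (axis R false) f z)
  (Cderive (axis R true) (Cderive (axis R false) f) z)
  ((DeltaA (AEmon hq (idxP hq)) : A2) i : A)
  ((DeltaA (AEmon hq (idxP hq)) * BP hq : A2) i : A)
  ((DeltaA (AEmon hq (idxP hq)) * BM hq : A2) i : A)
  ((DeltaA (AEmon hq (idxP hq)) * (BP hq * BM hq) : A2) i : A).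
apply: etrans (h E0 _ _) _.
- exact: AE2_eq0_coord (DeltaA_BP_eq0 hq (a := idxP hq) erefl).
- exact: AE2_eq0_coord (DeltaA_BPM_eq0 hq (a := idxP hq) (or_introl erefl)).
by apply: etrans (congr1 _ E1) _; rewrite !scalerA mulrC.
Qed.

Lemma invariant_unique : exists c, forall F, inA0 F -> phi F = c * IE F.
Proof.
pose psi f := phi (fun z => f z *: AEmon hq (idx_top hq)).
have [c f f' cf cf'|b f cf|k hk] := @IC_unique R psi.
- rewrite /psi -phi_lin; [|exact: inA0_scale|exact: inA0_scale].
  by congr phi; apply/funext => z; rewrite scalerDl scalerA.
- exact: invariant_derive_eq0.
(* The factor [q] undoes the normalisation [q^-1] in [IA]. *)
exists (k * q) => F hF; have cF := (inA0P F).1 hF.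
rewrite IEE mulrACA divff ?(prim_root_neq0 hq) // mulr1.
rewrite -hk // [in LHS](_ : F = fun z => \sum_i F z i *: AEmon hq i); last first.
  by apply/funext => z; exact: AEmon_decomp.
rewrite linear_on_A0_sum => [|i]; last exact: inA0_scale.
rewrite (bigD1 (idx_top hq)) //= big1 ?addr0 => [|i it]; last exact: invariant_mon_eq0.
by congr phi; apply/funext => z; rewrite AEmon_coord.
Qed.
End Uniqueness.

(** The first conjunct ties [IE], defined through coordinates, to the formula on an arbitrary
    representation of its argument, so that the value does not depend on the representation. *)
Theorem theorem2 (R : realType) (p : nat) (q : R[i]) (hp : (3 <= p)%N)
    (podd : odd p) (hq : p.-primitive_root q) :
  [/\ forall (n : nat) (a : 'I_n -> AE hq) (f : 'I_n -> R * R -> R[i]),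
        (forall k, Csmooth_c (f k)) ->
        IE (fun z => \sum_k f k z *: a k) = \sum_k IA (a k) * IC (f k),
      invariant_integral (@IE R p q hq)
    & forall phi : (R * R -> AE hq) -> R[i], invariant_integral phi ->
        exists c : R[i], forall F, inA0 F -> phi F = c * IE F].
Proof.
split=> [n a f cf||phi [phi_lin phi_inv]].
- rewrite (linear_on_A0_sum (@IE_lin R p q hq)) => [|k]; last exact: inA0_scale.
  apply: eq_bigr => k _; rewrite IEE IAE mulrAC; congr (_ * _); rewrite -ICZ //; congr IC.
  by apply/funext => z; rewrite AE_scaleE mulrC.
- exact: IE_invariant.
- by apply: invariant_unique => // F hF; exact: (phi_inv F hF).1.
Qed.
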